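(* Let $\eta$ be an indecomposable endomorphism of a vector space $U$ over $\mathbf k$ such that $\eta$ has no eigenvalue in $\mathbf k$ and the sextuple $\mathcal S_\eta$ is self-dual. Let $q(x)^m$ be the minimal polynomial of $\eta$, with $q(x)$ irreducible and $\deg q(x)=l$. Let $B_1$ and $B_2$ be compatible forms for $\mathcal S_\eta$, each symmetric or skew-symmetric, and put $\epsilon=\varepsilon(B_1)\varepsilon(B_2)$. Choose a basis of $U$ with respect to which $\eta$ has matrix $ZI+N^l$, where $Z\in\mathbf k^{l\times l}$ satisfies $\det(xI_l-Z)=q(x)$; extend it to a frame basis of $\mathcal S_\eta$; let $H_1,H_2$ be the coordinate matrices of $B_1,B_2$ with respect to this frame basis; and let $F=\mathbf k(Z)\subseteq\mathbf k^{l\times l}$ be the subfield generated by $Z$ over $\mathbf k$. 1. If $\epsilon=1$, then $H_1$ and $H_2$ are equivalent up to automorphisms of $\mathcal S_\eta$ and multiplication by ''scalars'' in $F^+_{H_1}$: there exist $0\neq Z'\in F^+_{H_1}$ and an automorphism $f$ of $\mathcal S_\eta$ which is an isometry from $B_2$ to the compatible form with matrix $H_1Z'$. 2. Given $0\neq K\in F$, there is an automorphism $f$ of $\mathcal S_\eta$ which is an isometry from $H_1$ to $H_1K$ if and only if there are $X\in F^+_{H_1}$ and $Y\in F^-_{H_1}$ such that $K=X^2-Y^2$.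
   Context: Standing assumptions: $\mathbf k$ is a perfect field with $\operatorname{char}\mathbf k\neq 2$; all vector spaces are finite-dimensional over $\mathbf k$. A sextuple $(V;C_i,I_i)$ in $V$ consists of subspaces $I_i\subseteq C_i\subseteq V$, $i=1,2,3$. Isomorphisms are linear bijections $f:V\to V'$ with $f(I_i)=I_i'$, $f(C_i)=C_i'$. The dual of $(V;C_i,I_i)$ is the sextuple in $V^*$ with $C_i$-members $I_i^\circ$ and $I_i$-members $C_i^\circ$ ($^\circ$ = annihilator); self-dual means isomorphic to its dual. A compatible form is a non-degenerate bilinear form on $V$, symmetric or skew-symmetric, such that $C_i=I_i^\perp$ for $i=1,2,3$. $\varepsilon(B)=1$ if $B$ is symmetric, $-1$ if skew-symmetric. An isometry from a form $B$ to a form $B'$ on $V$ is a linear bijection $f$ with $B'(fx,fy)=B(x,y)$ for all $x,y$. An endomorphism $(U,\eta)$ is indecomposable if $U\neq0$ and $U$ is not a direct sum of two nonzero $\eta$-invariant subspaces. For $(U,\eta)$, the sextuple $\mathcal S_\eta$ is, in $V=U\times U\times U$: $I_1=U\times0\times0$, $I_2=0\times0\times U$, $I_3=\{(-\eta x,x,-x)\mid x\in U\}$, $C_1=U\times U\times0$, $C_2=0\times U\times U$, $C_3=\{(x,-x,0)\mid x\in U\}+I_3$. The frame basis of $\mathcal S_\eta$ extending a basis $(x_i)$ of $U$ consists of $u_i=(x_i,0,0)$, then $v_i=(0,x_i,0)$, then $w_i=(0,0,x_i)$. $ZI$ denotes the block diagonal matrix with all diagonal blocks equal to $Z$; $N\in\mathbf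 k^{ml\times ml}$ has $1$ on the first upper off-diagonal and $0$ elsewhere, so $N^l$ has identity blocks $I_l$ on the first upper block off-diagonal. A basis of $U$ as in the claim exists because $\mathbf k$ is perfect. For a $3ml\times3ml$ matrix $H$, viewed as a block matrix with $l\times l$-blocks, and $W\in\mathbf k^{l\times l}$, $HW$ (resp. $WH$) denotes the matrix obtained by multiplying each block by $W$ on the right (resp. left). $F^{\pm}_{H_1}=\{W\in F\mid W^tH_1=\pm H_1W\}$. *)

(* Defs.v *)
From HB Require Import structures.
From mathcomp Require Import all_boot all_order all_algebra all_field.
From mathcomp Require Export sesquilinear.
From mathcomp Require Export mxtens.

Set Implicit Arguments.
Unset Strict Implicit.
Unset Printing Implicit Defensive.

Import GRing.Theory.
Local Open Scope ring_scope.

Definition perfect_field (k : fieldType) : Prop :=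
  forall p : {poly k}, irreducible_poly p -> separable_poly p.

Section Sextuples.
Variable k : fieldType.
Implicit Types V U : vectType k.

Record sextuple V := Sextuple {
  sextC : 'I_3 -> {vspace V};
  sextI : 'I_3 -> {vspace V};
  sextP : forall i, (sextI i <= sextC i)%VS
}.

Definition sext_iso V V' (S : sextuple V) (S' : sextuple V')
    (f : 'Hom(V, V')) : Prop :=
  [/\ bijective f,
      forall i, (f @: sextI S i)%VS = sextI S' i &
      forall i, (f @: sextC S i)%VS = sextC S' i].

Definition sext_aut V (S : sextuple V) (f : 'End(V)) : Prop := sext_iso S S f.

Definition dual_eval V (v : V) (phi : 'Hom(V, k^o)) : k^o := phi v.

Fact dual_eval_is_linear V (v : V) : linear (dual_eval v).
Proof. by move=> a f g; rewrite /dual_eval add_lfunE scale_lfunE. Qed.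

HB.instance Definition _ V (v : V) :=
  GRing.isSemilinear.Build k 'Hom(V, k^o) k^o _ (dual_eval v)
    (GRing.semilinear_linear (dual_eval_is_linear v)).

(* The dual space of V is 'Hom(V, k^o). *)
Definition annihilator V (W : {vspace V}) : {vspace 'Hom(V, k^o)} :=
  (\bigcap_(i < \dim W) lker (linfun (dual_eval (vbasis W)`_i)))%VS.

Lemma annihilatorP V (W : {vspace V}) (phi : 'Hom(V, k^o)) :
  reflect {in W, forall v, phi v = 0} (phi \in annihilator W).
Proof.
rewrite memvE; apply: (iffP subv_bigcapP) => [phi0 v vW | phi0 i _].
  rewrite (coord_vbasis vW) linear_sum big1 // => i _; rewrite linearZ /=.
  have := phi0 i isT; rewrite -memvE memv_ker lfunE /= /dual_eval => /eqP->.
  exact: scaler0.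
rewrite -memvE memv_ker lfunE /= /dual_eval phi0 //.
by apply/vbasis_mem/mem_nth; rewrite size_tuple.
Qed.

Lemma annihilatorS V (W1 W2 : {vspace V}) :
  (W1 <= W2)%VS -> (annihilator W2 <= annihilator W1)%VS.
Proof.
move=> /subvP sW; apply/subvP => phi /annihilatorP phi0.
by apply/annihilatorP => v /sW/phi0.
Qed.

Definition sext_dual V (S : sextuple V) : sextuple 'Hom(V, k^o) :=
  @Sextuple _ (fun i => annihilator (sextI S i))
              (fun i => annihilator (sextC S i))
              (fun i => annihilatorS (sextP S i)).

Definition self_dual V (S : sextuple V) : Prop :=
  exists f : 'Hom(V, 'Hom(V, k^o)), sext_iso S (sext_dual S) f.

(* eps = false for symmetric forms, eps = true for skew-symmetric ones. *)
Definition compatible V (S : sextuple V) (eps : bool)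
    (B : {hermitian V for eps & idfun}) : Prop :=
  nondegenerate B /\ forall i, sextC S i = orthov B (sextI S i).

Definition sign_of (eps : bool) : int := (-1) ^+ eps.

Definition is_isometry V (B B' : V -> V -> k) (f : 'End(V)) : Prop :=
  bijective f /\ forall x y, B' (f x) (f y) = B x y.

Definition indecomposable U (eta : 'End(U)) : Prop :=
  {:U}%VS != 0%VS /\
  forall W1 W2 : {vspace U},
    (eta @: W1 <= W1)%VS -> (eta @: W2 <= W2)%VS ->
    (W1 + W2)%VS = fullv -> (W1 :&: W2)%VS = 0%VS ->
    W1 = 0%VS \/ W2 = 0%VS.

Definition lfun_horner U (p : {poly k}) (eta : 'End(U)) : 'End(U) :=
  \sum_(i < size p) p`_i *: iter i (comp_lfun eta) \1%VF.

Definition is_minpoly U (eta : 'End(U)) (p : {poly k}) : Prop :=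
  [/\ p \is monic, lfun_horner p eta = 0 &
      forall r : {poly k}, r != 0 -> lfun_horner r eta = 0 ->
        (size p <= size r)%N].

Section SextupleOfEndomorphism.
Variables (U : vectType k) (eta : 'End(U)).

Definition triple (x y z : U) : (U * U * U)%type := (x, y, z).

Definition in1 (x : U) := triple x 0 0.
Definition in2 (x : U) := triple 0 x 0.
Definition in3 (x : U) := triple 0 0 x.
Definition inI3 (x : U) := triple (- eta x) x (- x).
Definition inC3 (x : U) := triple x (- x) 0.

Fact in1_is_linear : linear in1.
Proof. by move=> a x y; congr (_, _, _) => /=; rewrite ?scaler0 ?addr0. Qed.
Fact in2_is_linear : linear in2.
Proof. by move=> a x y; congr (_, _, _) => /=; rewrite ?scaler0 ?addr0. Qed.
Fact in3_is_linear : linear in3.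
Proof. by move=> a x y; congr (_, _, _) => /=; rewrite ?scaler0 ?addr0. Qed.
Fact inI3_is_linear : linear inI3.
Proof.
by move=> a x y; congr (_, _, _) => /=; rewrite ?linearP /= ?opprD ?scalerN.
Qed.
Fact inC3_is_linear : linear inC3.
Proof.
by move=> a x y; congr (_, _, _) => /=; rewrite ?opprD ?scalerN ?scaler0 ?addr0.
Qed.

HB.instance Definition _ := GRing.isSemilinear.Build k U (U * U * U)%type _ in1
  (GRing.semilinear_linear in1_is_linear).
HB.instance Definition _ := GRing.isSemilinear.Build k U (U * U * U)%type _ in2
  (GRing.semilinear_linear in2_is_linear).
HB.instance Definition _ := GRing.isSemilinear.Build k U (U * U * U)%type _ in3
  (GRing.semilinear_linear in3_is_linear).
HB.instance Definition _ := GRing.isSemilinear.Build k U (U * U * U)%type _ inI3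
  (GRing.semilinear_linear inI3_is_linear).
HB.instance Definition _ := GRing.isSemilinear.Build k U (U * U * U)%type _ inC3
  (GRing.semilinear_linear inC3_is_linear).

Definition endI (i : 'I_3) : {vspace (U * U * U)%type} :=
  tnth [tuple limg (linfun in1); limg (linfun in3); limg (linfun inI3)] i.

Definition endC (i : 'I_3) : {vspace (U * U * U)%type} :=
  tnth [tuple (limg (linfun in1) + limg (linfun in2))%VS;
              (limg (linfun in2) + limg (linfun in3))%VS;
              (limg (linfun inC3) + limg (linfun inI3))%VS] i.

Fact endIC i : (endI i <= endC i)%VS.
Proof.
by case: i => [[|[|[|//]]] lti]; rewrite /endI /endC !(tnth_nth 0%VS) /=;
  rewrite ?addvSl ?addvSr.
Qed.

Definition sextuple_of : sextuple (U * U * U)%type := Sextuple endIC.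

Fact frame_subproof m l (X : (m * l).-tuple U) :
  size (map in1 X ++ map in2 X ++ map in3 X) == (3 * m * l)%N.
Proof.
by rewrite !size_cat !size_map size_tuple -mulnA !mulSn mul0n addn0.
Qed.

Definition frame m l (X : (m * l).-tuple U) :
  (3 * m * l).-tuple (U * U * U)%type := Tuple (frame_subproof X).

End SextupleOfEndomorphism.

(* Column convention: the j-th column holds the coordinates of eta X_j. *)
Definition lfun_mx U n (X : n.-tuple U) (eta : 'End(U)) : 'M[k]_n :=
  \matrix_(i, j) coord X i (eta X`_j).

Definition gram V n (X : n.-tuple V) (B : V -> V -> k) : 'M[k]_n :=
  \matrix_(i, j) B X`_i X`_j.

Definition form_of_gram V n (X : n.-tuple V) (M : 'M[k]_n) (x y : V) : k :=
  \sum_i \sum_j coord X i x * M i j * coord X j y.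

Definition shift_mx n : 'M[k]_n := \matrix_(i, j) (i.+1 == j :> nat)%:R.

(* mxtens_index (a, i) = a * l + i is the index of the i-th row of the a-th
   block of rows. *)
Definition block n l (H : 'M[k]_(n * l)) (a b : 'I_n) : 'M[k]_l :=
  \matrix_(i, j) H (mxtens_index (a, i)) (mxtens_index (b, j)).

Definition of_blocks n l (E : 'I_n -> 'I_n -> 'M[k]_l) : 'M[k]_(n * l) :=
  \matrix_(p, q) E (mxtens_unindex p).1 (mxtens_unindex q).1
                   (mxtens_unindex p).2 (mxtens_unindex q).2.

Definition block_diag n l (Z : 'M[k]_l) : 'M[k]_(n * l) :=
  of_blocks (fun a b => if a == b then Z else 0).

Definition block_mulr n l (H : 'M[k]_(n * l)) (W : 'M[k]_l) : 'M[k]_(n * l) :=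
  of_blocks (fun a b => block H a b *m W).

Definition block_mull n l (W : 'M[k]_l) (H : 'M[k]_(n * l)) : 'M[k]_(n * l) :=
  of_blocks (fun a b => W *m block H a b).

(* k(Z): the closure of the scalar matrices and Z under the field operations;
   invmx is the identity on matrices that are not invertible. *)
Inductive gen_field l (Z : 'M[k]_l) : 'M[k]_l -> Prop :=
  | gen_scalar a : gen_field Z a%:M
  | gen_Z : gen_field Z Z
  | gen_add A B : gen_field Z A -> gen_field Z B -> gen_field Z (A + B)
  | gen_opp A : gen_field Z A -> gen_field Z (- A)
  | gen_mul A B : gen_field Z A -> gen_field Z B -> gen_field Z (A *m B)
  | gen_inv A : gen_field Z A -> gen_field Z (invmx A).

Definition Fplus n l (Z : 'M[k]_l) (H : 'M[k]_(n * l)) (W : 'M[k]_l) : Prop :=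
  gen_field Z W /\ block_mull W^T H = block_mulr H W.

Definition Fminus n l (Z : 'M[k]_l) (H : 'M[k]_(n * l)) (W : 'M[k]_l) : Prop :=
  gen_field Z W /\ block_mull W^T H = - block_mulr H W.

End Sextuples.

(* Main.v *)
Require Import Defs.
From HB Require Import structures.
From mathcomp Require Import all_boot all_order all_algebra all_field.
From mathcomp Require Import ring.
Set Implicit Arguments.
Unset Strict Implicit.
Unset Printing Implicit Defensive.
Import GRing.Theory.
Local Open Scope ring_scope.

(** The subspaces I_1, C_1, C_2, I_2 force an automorphism of S_eta to be
    block diagonal, and I_3, C_3 force its three blocks to be one and the same
    automorphism g of U commuting with eta ([sext_aut_diag3]).  In the same way
    a compatible form B is determined by its middle block Q, the form
    Q(x,y) = B((0,x,0),(0,y,0)):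
      B((x1,x2,x3),(y1,y2,y3)) = Q(x2,y2) - Q(x1,y3) - Q(x3,y1),
    where Q is nondegenerate, has the symmetry of B and satisfies
    Q(eta x, y) + Q(x, eta y) = Q(x, y) ([compatibleE], [middle_eta]).  So the
    adjoint of eta with respect to Q is 1 - eta, and both claims become claims
    about one form on U ([diag3_gramP], [block_adjointP]).

    Let E be the matrix of eta, D its block diagonal part diag(Z, ..., Z), and Q
    the Gram matrix of the middle form.  The minimal polynomial q^m has degree
    dim U, so every matrix that commutes with E is a polynomial in E
    ([centralizer_cyclic]); the adjoint of r(E) is r(1 - E).  In particular
    D = p(E), where q(p) = 0 and p = x modulo q^m and q respectively.  As q is
    separable (k is perfect), such a p is unique modulo q^m
    ([separable_root_mod_uniq]); applied to p(1 - x) and 1 - p(x) this says that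
    the adjoint of D is 1 - D ([adjoint_semisimple]).  Hence F = k(Z), embedded
    block diagonally, is stable under the adjunction, which acts on it by the
    involution r(Z) |-> r(1 - Z), and F^+ and F^- are its eigenspaces.

    Claim 1.  If Q1 and Q2 have the same symmetry, C = Q1^-1 Q2 commutes with E
    and is self-adjoint for Q1, say C = c(E).  Then Z' = c(Z) is self-adjoint as
    well and C = diag(Z') (1 + nilpotent) with commuting factors.  As 2 is
    invertible, 1 + nilpotent = S^2 with S a polynomial in a self-adjoint
    matrix, hence self-adjoint, so that Q2 = Q1 C = S^T (Q1 diag(Z')) S
    ([selfadjoint_scalar_times_square]).

    Claim 2.  An isometry g = c(E) satisfies c(1 - E) K c(E) = 1; modulo q this
    says that K = h h* in F, with h the inverse of c(Z) and * the involution
    ([scaled_isometry_norm]).  Splitting h = X + Y into its parts in F^+ and F^-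
    gives h h* = X^2 - Y^2.  Conversely, from K = X^2 - Y^2 one reads off h = X + Y,
    and h^-1 is the isometry. *)

(** * Evaluation of polynomials at square matrices *)

Section PolynomialsOfMatrices.
Variables (k : fieldType) (n : nat).
Implicit Types (A B Q : 'M[k]_n) (p r : {poly k}).

(** Unlike [horner_mx] this makes sense in every dimension, hence in dimension
    m * l as it stands; the sum is that of [lfun_horner] in coordinates. *)
Definition peval A p : 'M[k]_n := \sum_(i < size p) p`_i *: A ^+ i.

Lemma peval_wide A p d : (size p <= d)%N ->
  peval A p = \sum_(i < d) p`_i *: A ^+ i.
Proof.
move=> le_p_d; rewrite /peval (big_ord_widen d (fun i => p`_i *: A ^+ i)) //.
rewrite big_mkcond; apply: eq_bigr => i _; case: ltnP => // le_p_i.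
by rewrite nth_default // scale0r.
Qed.

Fact peval_is_linear A : linear (peval A).
Proof.
move=> a p r; pose d := maxn (size p) (size r).
have le_d: (size (a *: p + r)%R <= d)%N.
  rewrite (leq_trans (size_polyD _ _)) // geq_max leq_maxr andbT.
  by rewrite (leq_trans (size_scale_leq _ _)) ?leq_maxl.
rewrite (peval_wide _ le_d) (@peval_wide _ p d) ?leq_maxl //.
rewrite (@peval_wide _ r d) ?leq_maxr // scaler_sumr -big_split /=.
by apply: eq_bigr => i _; rewrite coefD coefZ scalerDl scalerA.
Qed.
HB.instance Definition _ A := GRing.isSemilinear.Build k {poly k} 'M[k]_n _
  (peval A) (GRing.semilinear_linear (peval_is_linear A)).

Lemma pevalC A a : peval A a%:P = a%:M.
Proof.
rewrite (@peval_wide _ _ 1) ?size_polyC ?leq_b1 // big_ord1 coefC eqxx.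
by rewrite expr0 scalemx1.
Qed.

Lemma pevalX A : peval A 'X = A.
Proof.
rewrite (@peval_wide _ _ 2) ?size_polyX // !big_ord_recl big_ord0 !coefX /=.
by rewrite scale0r scale1r add0r addr0 expr1.
Qed.

Lemma pevalMX A p : peval A (p * 'X) = peval A p * A.
Proof.
rewrite (@peval_wide _ _ (size p).+1); last first.
  by rewrite (leq_trans (size_polyMleq _ _)) // size_polyX addn2.
rewrite big_ord_recl coefMX /= scale0r add0r mulr_suml.
by apply: eq_bigr => i _; rewrite coefMX /= exprSr -!mulmxE scalemxAl.
Qed.

Fact peval_is_monoid_morphism A : monoid_morphism (peval A).
Proof.
split=> [|p r]; first by rewrite -polyC1 pevalC.
elim/poly_ind: r => [|r c IHr]; first by rewrite mulr0 !linear0 mulr0.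
rewrite mulrDr mulrA !linearD /= !pevalMX IHr mulrDr mulrA; congr (_ + _).
by rewrite mulrC mul_polyC linearZ /= pevalC -mulmxE mul_mx_scalar.
Qed.
HB.instance Definition _ A := GRing.isMonoidMorphism.Build {poly k} 'M[k]_n
  (peval A) (peval_is_monoid_morphism A).

Lemma peval1 A : peval A 1 = 1%:M.
Proof. exact: rmorph1. Qed.

Lemma pevalM A p r : peval A (p * r) = peval A p *m peval A r.
Proof. exact: rmorphM. Qed.

Lemma peval_comp A p r : peval A (p \Po r) = peval (peval A r) p.
Proof.
elim/poly_ind: p => [|p c IHp]; first by rewrite !linear0.
by rewrite comp_poly_MXaddC !rmorphD /= !rmorphM /= IHp !pevalC pevalX.
Qed.

(** Both commutation (A = B) and adjunction (A a transpose) are instances. *)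
Lemma peval_intertwine A B Q p :
  A *m Q = Q *m B -> peval A p *m Q = Q *m peval B p.
Proof.
move=> AQ; elim/poly_ind: p => [|p c IHp]; first by rewrite !linear0 mul0mx.
rewrite !rmorphD /= !rmorphM /= !pevalC !pevalX mulmxDl mulmxDr -!mulmxE.
by rewrite -mulmxA AQ mulmxA IHp !mulmxA mul_mx_scalar mul_scalar_mx.
Qed.

Lemma peval_comm A p r : peval A p *m peval A r = peval A r *m peval A p.
Proof. by rewrite !mulmxE -!rmorphM mulrC. Qed.

Lemma trmx_peval A p : (peval A p)^T = peval A^T p.
Proof.
elim/poly_ind: p => [|p c IHp]; first by rewrite !linear0.
have Xp: A^T *m peval A^T p = peval A^T p *m A^T.
  by have := peval_comm A^T 'X p; rewrite pevalX.
rewrite !rmorphD /= !rmorphM /= !pevalC !pevalX linearD /=.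
by rewrite trmx_mul tr_scalar_mx IHp Xp.
Qed.

Lemma peval_adjoint A B Q p :
  A^T *m Q = Q *m B -> (peval A p)^T *m Q = Q *m peval B p.
Proof. by rewrite trmx_peval; apply: peval_intertwine. Qed.

End PolynomialsOfMatrices.

(** * Congruences modulo a power of an irreducible polynomial *)
Section PolynomialCongruences.
Variable k : fieldType.
Implicit Types (q p a b h : {poly k}).

(** Taylor expansion to second order.  It is stated without divided
    derivatives, since only the linear term has to be known explicitly. *)
Lemma comp_poly_taylor2 p b h :
  exists s, p \Po (b + h) = p \Po b + h * (p^`() \Po b) + h ^+ 2 * s.
Proof.
elim/poly_ind: p => [|p c [s IHp]].
  by exists 0; rewrite deriv0 !comp_poly0; ring.
exists ((p^`() \Po b) + s * (b + h)).
rewrite derivMXaddC !comp_poly_MXaddC comp_polyD comp_polyM comp_polyX IHp.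
by ring.
Qed.

Lemma dvdp_comp_polyB p a b : a - b %| (p \Po a) - (p \Po b).
Proof.
have [s] := comp_poly_taylor2 p b (a - b); rewrite addrC subrK => ->.
rewrite [_ + _ + _ - _](_ : _ = (a - b) * ((p^`() \Po b) + (a - b) * s)).
  exact: dvdp_mulIl.
by ring.
Qed.

Lemma irredp_dvd_exp q a m : irreducible_poly q -> q %| a ^+ m -> q %| a.
Proof.
move=> q_irr; apply: contraLR; rewrite -!irreducible_poly_coprime //.
exact: coprimep_expr.
Qed.

Lemma coprimep_inv_mod q a : coprimep q a -> exists b, q %| a * b - 1.
Proof.
case/Bezout_eq1_coprimepP=> -[u v] /= uv1; exists v.
by rewrite -uv1 (_ : _ - _ = - u * q) ?dvdp_mulIr //; ring.
Qed.

(** Uniqueness in Hensel's lemma: by Taylor expansion q(a) - q(b) is the product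
    of a - b and q'(b) + (a - b) s, and the second factor is prime to q because
    q' is prime to q. *)
Lemma separable_root_mod_uniq q a b m : separable_poly q ->
    q ^+ m %| q \Po a -> q ^+ m %| q \Po b -> q %| a - b ->
  q ^+ m %| a - b.
Proof.
case: m => [|m] q_sep qa qb qab; first by rewrite expr0 dvd1p.
have [s] := comp_poly_taylor2 q b (a - b); rewrite addrC subrK => qaE.
have cop: coprimep q ((a - b) * s + (q^`() \Po b)).
  have [t ->] := dvdpP _ _ qab; rewrite mulrAC coprimep_addl_mul.
  apply: coprimep_dvdr (coprimep_comp_poly b _).
    exact: dvdp_trans (dvdp_exp _ _) qb.
  by move: q_sep; rewrite unlock.
rewrite -(Gauss_dvdpl (a - b) (coprimep_expl m.+1 cop)).
by rewrite (_ : _ * _ = (q \Po a) - (q \Po b)) ?dvdp_sub // qaE; ring.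
Qed.

(** The truncated binomial series of a square root of 1 + X, built one
    coefficient at a time; the normalization t(0) = 1 makes the next
    coefficient the solution of a linear equation with coefficient 2. *)
Lemma sqrt_mod_Xn m : 2%N \notin [pchar k] ->
  exists2 t : {poly k}, 'X^(m.+1) %| t ^+ 2 - (1 + 'X) & t.[0] = 1.
Proof.
move=> k2; have nz2: (2%:R : k) != 0 by apply: contra k2; rewrite inE.
elim: m => [|m [t /dvdpP[a ta] t0]].
  exists 1; last by rewrite hornerE.
  by rewrite expr1n opprD addrA subrr sub0r expr1 dvdpNr dvdpp.
(* The error a X^(m+1) of t is cancelled to first order by -(a(0)/2) X^(m+1). *)
pose c := a.[0] / 2%:R; exists (t - c%:P * 'X^(m.+1)); last first.
  by rewrite !hornerE t0 expr0n mulr0 subr0.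
have -> : (t - c%:P * 'X^(m.+1)) ^+ 2 - (1 + 'X) =
    (a - c%:P * t *+ 2 + c%:P ^+ 2 * 'X^(m.+1)) * 'X^(m.+1).
  rewrite mulrDl mulrBl -ta; ring.
rewrite exprS dvdp_mul2r ?expf_neq0 ?polyX_eq0 //.
rewrite -[X in X %| _]subr0 -polyC0 dvdp_XsubCl rootE.
rewrite !hornerE t0 expr0n /= mulr0 addr0 mulr1.
by rewrite -mulr2n -mulr_natr divfK ?subrr.
Qed.

(** The root is a polynomial t evaluated at e, so that it inherits every
    property of e that is stable under polynomials, such as self-adjointness. *)
Lemma sqrt_mod_exp q e m : 2%N \notin [pchar k] -> q %| e - 1 ->
  exists t, q ^+ m %| (t \Po e) ^+ 2 - e.
Proof.
move=> k2 qe; have [t tX _] := sqrt_mod_Xn m k2.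
exists (t \Po ('X - 1)); rewrite -comp_polyA rmorphB /= comp_polyX rmorph1.
have := dvdp_comp_poly (e - 1) tX.
rewrite rmorphB rmorphD !rmorphXn rmorph1 /= comp_polyX.
rewrite [1 + _]addrC subrK; apply: dvdp_trans.
by rewrite (dvdp_trans (dvdp_exp2r m qe)) // exprS dvdp_mull.
Qed.

End PolynomialCongruences.

(** * Matrices whose minimal polynomial is a power of q of full degree *)
Section CyclicMatrix.
Variables (k : fieldType) (n : nat) (E : 'M[k]_n) (q : {poly k}) (m : nat).
Hypothesis q_irr : irreducible_poly q.
Hypothesis minE : forall r, (q ^+ m.+1 %| r) = (peval E r == 0).
Hypothesis size_qm : size (q ^+ m.+1) = n.+1.

(** Any v not killed by q(E)^m works: its annihilator divides q^(m+1) and does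
    not divide q^m. *)
Lemma exists_cyclic_vector :
  exists v : 'rV[k]_n, forall r, v *m peval E r = 0 -> q ^+ m.+1 %| r.
Proof.
have q_neq0 := irredp_neq0 q_irr.
have nz: peval E (q ^+ m) != 0.
  rewrite -minE exprS -[X in _ %| X]mul1r dvdp_mul2r ?expf_neq0 //.
  by case: q_irr => q_gt1 _; rewrite dvdp1 gtn_eqF.
have [i vi] : exists i, row i (peval E (q ^+ m)) != 0.
  apply/existsP; apply: contraNT nz => /existsPn eq0; apply/eqP/row_matrixP => i.
  by apply/eqP; rewrite row0; move: (eq0 i); rewrite negbK.
exists (delta_mx 0 i) => r vr.
(* If q^j divides r but q^(j+1) does not, the cofactor s is invertible modulo
   q^(m+1), and r(E) v = 0 would imply q(E)^m v = 0. *)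
suff: forall j, (j <= m.+1)%N -> q ^+ j %| r by apply.
elim=> [|j IHj] lt_j; first by rewrite expr0 dvd1p.
have [s def_r] := dvdpP _ _ (IHj (ltnW lt_j)); rewrite def_r.
rewrite exprS dvdp_mul2r ?expf_neq0 //; apply: contraNT vi.
rewrite -irreducible_poly_coprime // => /(coprimep_expl m.+1)/Bezout_eq1_coprimepP[[u w]].
move=> /= uw; rewrite rowE.
have -> : q ^+ m = r * (w * q ^+ (m - j)) + u * q ^+ m * q ^+ m.+1.
  have qmE: q ^+ m = q ^+ j * q ^+ (m - j) by rewrite -exprD subnKC.
  rewrite -[LHS]mulr1 -uw def_r (_ : _ * q ^+ j * _ = w * s * q ^+ m).
    by set x := q ^+ m; set y := q ^+ m.+1; ring.
  by rewrite qmE; ring.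
rewrite rmorphD !rmorphM /=.
have -> : peval E (q ^+ m.+1) = 0 by apply/eqP; rewrite -minE.
by rewrite mulr0 addr0 -mulmxE mulmxA vr mul0mx.
Qed.

(** The vectors v E^i form a basis, so v C = v c(E) for some c; a matrix that
    commutes with E is determined by the image of v. *)
Lemma centralizer_cyclic (C : 'M[k]_n) :
  C *m E = E *m C -> exists c, C = peval E c.
Proof.
move=> CE; have [v cyc_v] := exists_cyclic_vector.
pose M : 'M_n := \matrix_i (v *m E ^+ i).
have mulM (u : 'rV_n) : u *m M = v *m peval E (rVpoly u).
  rewrite (@peval_wide _ _ _ _ n) ?size_poly // mulmx_sum_row mulmx_sumr.
  by apply: eq_bigr => i _; rewrite rowK coef_rVpoly_ord scalemxAr.
have Mfree: row_free M.
  rewrite -kermx_eq0; apply/rowV0P => u /sub_kermxP; rewrite mulM => /cyc_v dv.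
  apply: (can_inj rVpolyK); rewrite linear0; apply/eqP; apply: contraTT dv.
  by move=> nz; rewrite gtNdvdp // size_qm ltnS size_poly.
have Munit: M \in unitmx by rewrite -row_free_unit.
exists (rVpoly (v *m C *m invmx M)).
apply: (can_inj (mulKmx Munit)); apply/row_matrixP=> i.
have powE A : A *m E = E *m A -> v *m E ^+ i *m A = v *m A *m E ^+ i.
  by rewrite -!mulmxA !mulmxE => AE; congr (v *m _); apply/commr_sym/commrX.
have cE c : peval E c *m E = E *m peval E c.
  by have := peval_comm E c 'X; rewrite pevalX.
rewrite !row_mul rowK (powE _ CE) (powE _ (cE _)); congr (_ *m _).
by rewrite -mulM mulmxKV.
Qed.
End CyclicMatrix.

(** * The adjoint of the semisimple part *)
Section Reflection.
Variable k : fieldType.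
Implicit Types r : {poly k}.

(** If 1 - E is the adjoint of E, this operation on r describes the adjoint
    of r(E). *)
Definition reflect_poly r := r \Po (1 - 'X).

Lemma reflect_polyK r : reflect_poly (reflect_poly r) = r.
Proof.
rewrite /reflect_poly -comp_polyA rmorphB /= rmorph1 comp_polyX.
by rewrite opprB addrCA subrr addr0 comp_polyXr.
Qed.

Lemma peval_reflect n (A : 'M[k]_n) r :
  peval A (reflect_poly r) = peval (1%:M - A) r.
Proof. by rewrite peval_comp rmorphB /= rmorph1 pevalX. Qed.

End Reflection.

Lemma comm_invmx (k : fieldType) n (A S : 'M[k]_n) :
  S \in unitmx -> S *m A = A *m S -> invmx S *m A = A *m invmx S.
Proof.
move=> Su SA; apply: (can_inj (mulKmx Su)).
by rewrite !mulmxA mulmxV // mul1mx SA mulmxK.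
Qed.

(** Two forms giving E the same adjoint differ by a matrix commuting with E. *)
Lemma adjoint_quotient_comm (k : fieldType) n (E Q C : 'M[k]_n) :
    Q \in unitmx -> E^T *m Q = Q *m (1%:M - E) ->
    E^T *m (Q *m C) = Q *m C *m (1%:M - E) ->
  C *m E = E *m C.
Proof.
move=> Qu EQ EQC; apply: (can_inj (mulKmx Qu)); apply: oppr_inj.
apply: (addrI (Q *m C)); rewrite [Q *m (C *m E)]mulmxA [Q *m (E *m C)]mulmxA.
have -> : Q *m C - Q *m C *m E = Q *m C *m (1%:M - E) by rewrite mulmxBr mulmx1.
have -> : Q *m C - Q *m E *m C = Q *m (1%:M - E) *m C.
  by rewrite mulmxBr mulmx1 mulmxBl.
by rewrite -EQC -EQ mulmxA.
Qed.

(** In this section D + (E - D) is the Jordan-Chevalley decomposition of E, and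
    1 - E is the adjoint of E for the form Q. *)
Section SemisimplePart.
Variables (k : fieldType) (n : nat) (E D Q : 'M[k]_n) (q : {poly k}) (m : nat).
Hypothesis q_irr : irreducible_poly q.
Hypothesis q_sep : separable_poly q.
Hypothesis minE : forall r, (q ^+ m.+1 %| r) = (peval E r == 0).
Hypothesis size_qm : size (q ^+ m.+1) = n.+1.
Hypothesis DE : D *m E = E *m D.
Hypothesis qD : peval D q = 0.
Hypothesis nilED : (E - D) ^+ m.+1 = 0.

(** D commutes with the cyclic matrix E.  By [separable_root_mod_uniq] the two
    divisibilities determine p modulo q^(m+1). *)
Lemma semisimple_part_poly :
  exists p, [/\ D = peval E p, q ^+ m.+1 %| q \Po p & q %| p - 'X].
Proof.
have [p Dp] := centralizer_cyclic q_irr minE size_qm DE.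
exists p; split=> //; first by rewrite minE peval_comp -Dp qD.
rewrite -opprB dvdpNr; apply: (@irredp_dvd_exp _ _ _ m.+1) => //.
apply: dvdp_trans (_ : q ^+ m.+1 %| _); first by rewrite exprS dvdp_mulr.
by rewrite minE rmorphXn rmorphB /= pevalX -Dp nilED.
Qed.

Hypothesis Qu : Q \in unitmx.
Hypothesis EQ : E^T *m Q = Q *m (1%:M - E).

(** 1 - E is conjugate to the transpose of E, so q^(m+1) kills it too. *)
Lemma dvdp_reflect : q %| reflect_poly q.
Proof.
apply: (@irredp_dvd_exp _ _ _ m.+1) => //; rewrite /reflect_poly -rmorphXn /=.
apply: dvdp_trans (_ : q ^+ m.+1 %| _); first by rewrite exprS dvdp_mulr.
rewrite minE peval_reflect; apply/eqP/(can_inj (mulKmx Qu)).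
rewrite -(peval_adjoint _ EQ) (_ : peval E _ = 0) ?trmx0 ?mul0mx ?mulmx0 //.
by apply/eqP; rewrite -minE.
Qed.

(** p(1 - x) and 1 - p(x) are both roots of q modulo q^(m+1) and agree modulo q,
    hence they are equal modulo q^(m+1). *)
Lemma adjoint_semisimple : D^T *m Q = Q *m (1%:M - D).
Proof.
have [p [Dp qp qpX]] := semisimple_part_poly.
rewrite {1}Dp (peval_adjoint _ EQ) -peval_reflect; congr (Q *m _); apply/eqP.
rewrite -subr_eq0 Dp -(peval1 E) -!rmorphB -minE /=.
apply: separable_root_mod_uniq => //.
- rewrite comp_polyA; apply: dvdp_trans (dvdp_comp_poly _ qp).
  by rewrite rmorphXn dvdp_exp2r ?dvdp_reflect.
- have := dvdp_comp_poly p dvdp_reflect; rewrite -comp_polyA.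
  rewrite rmorphB /= rmorph1 comp_polyX; exact: dvdp_trans.
rewrite (_ : _ - _ = reflect_poly (p - 'X) + (p - 'X)); last first.
  by rewrite /reflect_poly rmorphB /= comp_polyX; ring.
rewrite dvdp_add // (dvdp_trans dvdp_reflect) //; exact: dvdp_comp_poly.
Qed.

Lemma peval_adjoint_semisimple r :
  (peval D r)^T *m Q = Q *m peval D (reflect_poly r).
Proof. by rewrite peval_reflect; apply: peval_adjoint adjoint_semisimple. Qed.

Lemma peval_semisimple0 r : q %| r -> peval D r = 0.
Proof. by case/dvdpP=> s ->; rewrite rmorphM /= qD mulr0. Qed.

Lemma dvdp_of_exp r : q ^+ m.+1 %| r -> q %| r.
Proof. by apply: dvdp_trans; rewrite exprS dvdp_mulr. Qed.

Lemma irredp_ndvd1 : ~~ (q %| 1).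
Proof. by case: q_irr => q_gt1 _; rewrite dvdp1 gtn_eqF. Qed.

Lemma unitmx_peval_ndvd c : peval E c \in unitmx -> ~~ (q %| c).
Proof.
move=> Cu; apply: contra irredp_ndvd1 => qc.
have [b defb] : exists b, invmx (peval E c) = peval E b.
  apply: (centralizer_cyclic q_irr minE size_qm).
  apply: comm_invmx => //; have := peval_comm E c 'X; by rewrite pevalX.
rewrite (_ : 1 = c * b - (c * b - 1)); last by ring.
rewrite dvdp_sub ?dvdp_mulr // dvdp_of_exp // minE.
by rewrite rmorphB /= pevalM -defb mulmxV // peval1 subrr.
Qed.

(** With C = c(E), the scalar is c0 = c(D), which is congruent to C modulo
    nilpotents, and S is a square root of c0^-1 C. *)
Lemma selfadjoint_scalar_times_square C : 2%N \notin [pchar k] -> C \in unitmx ->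
    C *m E = E *m C -> C^T *m Q = Q *m C ->
  exists r S, [/\ ~~ (q %| r), (peval D r)^T *m Q = Q *m peval D r,
     S *m E = E *m S, S \in unitmx & S^T *m Q *m peval D r *m S = Q *m C].
Proof.
move=> k2 Cu CE CQ; have [p [Dp qp qpX]] := semisimple_part_poly.
have [c defC] := centralizer_cyclic q_irr minE size_qm CE.
have c0c : q %| (c \Po p) - c.
  by apply: dvdp_trans qpX _; have := dvdp_comp_polyB c p 'X; rewrite comp_polyXr.
have DcQ : (peval D c)^T *m Q = Q *m peval D c.
  rewrite peval_adjoint_semisimple; congr (Q *m _); apply/eqP.
  rewrite -subr_eq0 -rmorphB /= peval_semisimple0 // dvdp_of_exp //.
  rewrite minE rmorphB /= subr_eq0 peval_reflect; apply/eqP.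
  by apply: (can_inj (mulKmx Qu)); rewrite -(peval_adjoint _ EQ) -defC.
have qc : ~~ (q %| c) by rewrite unitmx_peval_ndvd -?defC.
pose c0 := c \Po p; have Dc0: peval D c = peval E c0 by rewrite peval_comp -Dp.
have qc0 : ~~ (q %| c0).
  by apply: contra qc => qc0; rewrite -[c](subKr c0) dvdp_sub.
have [d c0d] : exists d, q ^+ m.+1 %| c0 * d - 1.
  by apply: coprimep_inv_mod; rewrite coprimep_expl ?irreducible_poly_coprime.
have [t te] : exists t, q ^+ m.+1 %| (t \Po (c * d)) ^+ 2 - c * d.
  apply: sqrt_mod_exp => //.
  rewrite (_ : _ - 1 = (c0 * d - 1) - (c0 - c) * d); last by ring.
  by rewrite dvdp_sub ?(dvdp_of_exp c0d) // dvdp_mulr.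
have c0dE : peval E c0 *m peval E d = 1%:M.
  by apply/eqP; rewrite -pevalM -(peval1 E) -subr_eq0 -rmorphB -minE.
have dQ : (peval E d)^T *m Q = Q *m peval E d.
  rewrite -[LHS]mulmx1 -c0dE mulmxA -[_ *m Q *m _]mulmxA -Dc0 -DcQ mulmxA.
  by rewrite -trmx_mul Dc0 c0dE trmx1 mul1mx.
pose W := peval E (c * d).
have WQ : W^T *m Q = Q *m W.
  rewrite /W pevalM trmx_mul -mulmxA -defC CQ mulmxA dQ defC -mulmxA.
  by rewrite peval_comm.
pose s := t \Po (c * d).
have SQ : (peval E s)^T *m Q = Q *m peval E s.
  by rewrite peval_comp -/W (peval_adjoint t WQ).
(* s^2 = c d and c0 d = 1 modulo q^(m+1) give c0 s^2 = c. *)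
have SC : (peval E s)^T *m Q *m peval D c *m peval E s = Q *m C.
  rewrite SQ Dc0 -!mulmxA -!pevalM defC; congr (Q *m _); apply/eqP.
  rewrite -subr_eq0 -rmorphB -minE /=.
  rewrite (_ : _ - c = c0 * (s ^+ 2 - c * d) + c * (c0 * d - 1)); last by ring.
  by rewrite dvdp_add ?dvdp_mull.
exists c, (peval E s); split=> //.
  by have := peval_comm E s 'X; rewrite pevalX.
have: Q *m C \in unitmx by rewrite unitmx_mul Qu.
by rewrite -SC unitmx_mul => /andP[].
Qed.

(** S = c(E) turns the hypothesis into c(1 - x) r(p(x)) c(x) = 1 modulo
    q^(m+1); modulo q one has p = x, and h is an inverse of c. *)
Lemma scaled_isometry_norm r S : S *m E = E *m S ->
    S^T *m Q *m peval D r *m S = Q ->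
  exists h, q %| r - h * reflect_poly h.
Proof.
move=> SE SQ; have [p [Dp qp qpX]] := semisimple_part_poly.
have [c defS] := centralizer_cyclic q_irr minE size_qm SE.
have rp : q %| (r \Po p) - r.
  by apply: dvdp_trans qpX _; have := dvdp_comp_polyB r p 'X; rewrite comp_polyXr.
have q1 : q %| reflect_poly c * r * c - 1.
  rewrite (_ : _ - 1 = (reflect_poly c * (r \Po p) * c - 1)
      - reflect_poly c * c * ((r \Po p) - r)); last by ring.
  rewrite dvdp_sub ?dvdp_mull // dvdp_of_exp // minE rmorphB /= !pevalM peval1.
  rewrite subr_eq0 peval_reflect peval_comp -Dp; apply/eqP.
  apply: (can_inj (mulKmx Qu)); rewrite mulmx1 -{2}SQ defS.
  by rewrite (peval_adjoint _ EQ) !mulmxA.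
have [h qh] : exists h, q %| c * h - 1.
  apply: coprimep_inv_mod; rewrite irreducible_poly_coprime //.
  apply: contra irredp_ndvd1 => qc.
  rewrite (_ : 1 = reflect_poly c * r * c - (reflect_poly c * r * c - 1)).
    by rewrite dvdp_sub // dvdp_mull.
  by ring.
have qrh : q %| reflect_poly c * reflect_poly h - 1.
  apply: dvdp_trans dvdp_reflect _; rewrite /reflect_poly -rmorphM.
  by have := dvdp_comp_poly (1 - 'X) qh; rewrite rmorphB /= rmorph1.
exists h.
rewrite (_ : _ - _ = h * reflect_poly h * (reflect_poly c * r * c - 1)
  - r * reflect_poly c * reflect_poly h * (c * h - 1)
  - r * (reflect_poly c * reflect_poly h - 1)); last by ring.
by rewrite !dvdp_sub ?dvdp_mull.
Qed.

End SemisimplePart.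

(** * Block matrices *)
Section BlockMatrices.
Variable k : fieldType.

Lemma pevalE n (A : 'M[k]_n.+1) r : peval A r = horner_mx A r.
Proof.
elim/poly_ind: r => [|r c IHr]; first by rewrite !linear0.
by rewrite !rmorphD /= !rmorphM /= IHr pevalC pevalX horner_mx_C horner_mx_X.
Qed.

Lemma peval_char_poly n (A : 'M[k]_n) : peval A (char_poly A) = 0.
Proof.
by case: n A => [|n] A; [exact: flatmx0 | rewrite pevalE Cayley_Hamilton].
Qed.

(** The Kronecker form makes products, transposes and commutation with the
    block shift [shift_mx_tens] immediate. *)
Lemma block_diag_tens n l (W : 'M[k]_l) : block_diag n W = tensmx 1%:M W.
Proof.
apply/matrixP=> i j; case: (mxtens_indexP i) (mxtens_indexP j) => a i'.
case=> b j'; rewrite tensmxE !mxE !mxtens_indexK /=.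
by case: eqP => _; rewrite ?mul1r // mul0r mxE.
Qed.

Lemma block_diagM n l (A B : 'M[k]_l) :
  block_diag n (A *m B) = block_diag n A *m block_diag n B.
Proof. by rewrite !block_diag_tens tensmx_mul mul1mx. Qed.

Lemma block_diagE n l (W : 'M[k]_l) (a b : 'I_n) i j :
  block_diag n W (mxtens_index (a, i)) (mxtens_index (b, j)) = (a == b)%:R * W i j.
Proof. by rewrite block_diag_tens tensmxE mxE. Qed.

Lemma block_diag_is_linear n l : linear (@block_diag k n l).
Proof.
move=> c A B; apply/matrixP=> i j; rewrite !mxE.
by case: eqP => _; rewrite !mxE ?mulr0 ?addr0.
Qed.
HB.instance Definition _ n l := GRing.isSemilinear.Build k 'M[k]_l 'M[k]_(n * l)
  _ (@block_diag k n l) (GRing.semilinear_linear (@block_diag_is_linear n l)).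

Lemma block_diag_scalar n l a : @block_diag k n l a%:M = a%:M.
Proof.
apply/matrixP=> i j; case: (mxtens_indexP i) (mxtens_indexP j) => a' i'.
case=> b j'; rewrite block_diagE !mxE (can_eq (@mxtens_indexK _ _)) xpair_eqE.
by case: (a' == b); rewrite ?mul1r ?mul0r.
Qed.

Lemma tr_block_diag n l (W : 'M[k]_l) : (block_diag n W)^T = block_diag n W^T.
Proof. by rewrite !block_diag_tens trmx_tens trmx1. Qed.

Lemma peval_block_diag n l (Z : 'M[k]_l) r :
  peval (block_diag n Z) r = block_diag n (peval Z r).
Proof.
elim/poly_ind: r => [|r c IHr]; first by rewrite !linear0.
rewrite !rmorphD /= !pevalM !pevalC !pevalX IHr linearD /= block_diagM.
by rewrite block_diag_scalar.
Qed.

Lemma block_mulrE n l (H : 'M[k]_(n * l)) W :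
  block_mulr H W = H *m block_diag n W.
Proof.
apply/matrixP=> i j; case: (mxtens_indexP i) (mxtens_indexP j) => a i'.
case=> b j'; rewrite !mxE !mxtens_indexK /=.
rewrite (reindex (@mxtens_index n l)) /=; last first.
  by exists (@mxtens_unindex n l) => x _; rewrite (mxtens_indexK, mxtens_unindexK).
rewrite (eq_bigr (fun p => H (mxtens_index (a, i')) (mxtens_index (p.1, p.2)) *
   ((p.1 == b)%:R * W p.2 j'))); last by case=> c d _; rewrite block_diagE.
rewrite -(pair_bigA _ (fun c d => H (mxtens_index (a, i')) (mxtens_index (c, d)) *
   ((c == b)%:R * W d j'))) /= (bigD1 b) //= [X in _ + X]big1 ?addr0 => [|c /negbTE->].
  by apply: eq_bigr => d _; rewrite !mxE eqxx mul1r.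
by rewrite big1 // => d _; rewrite mul0r mulr0.
Qed.

Lemma block_mulrN n l (H : 'M[k]_(n * l)) W : block_mulr H (- W) = - block_mulr H W.
Proof. by rewrite !block_mulrE linearN /= mulmxN. Qed.

Lemma block_mullE n l (H : 'M[k]_(n * l)) W :
  block_mull W H = block_diag n W *m H.
Proof.
apply: trmx_inj; rewrite trmx_mul tr_block_diag -block_mulrE.
apply/matrixP=> i j; rewrite !mxE; apply: eq_bigr => d _.
by rewrite !mxE mulrC.
Qed.

Lemma shift_mxX n j : shift_mx k n ^+ j = \matrix_(a, b) (a + j == b)%N%:R.
Proof.
elim: j => [|j IHj]; first by apply/matrixP=> a b; rewrite !mxE addn0.
rewrite exprSr IHj -mulmxE; apply/matrixP=> a b; rewrite !mxE.
have [lt_ajn|le_n_aj] := ltnP (a + j) n.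
  rewrite (bigD1 (Ordinal lt_ajn)) //= !mxE eqxx mul1r big1 ?addr0 => [|c].
    by rewrite addnS.
  by rewrite -val_eqE eq_sym !mxE => /negbTE->; rewrite mul0r.
rewrite big1 => [|c _]; first by rewrite gtn_eqF // (leq_trans (ltn_ord b)) // addnS leqW.
by rewrite !mxE gtn_eqF ?mul0r // (leq_trans (ltn_ord c)).
Qed.

Lemma shift_mx_nilp m l : (shift_mx k (m * l) ^+ l) ^+ m = 0.
Proof.
rewrite -exprM shift_mxX; apply/matrixP=> a b; rewrite !mxE gtn_eqF //.
by rewrite (leq_trans (ltn_ord b)) // [(l * m)%N]mulnC leq_addl.
Qed.

Lemma shift_mx_tens m l :
  shift_mx k (m * l) ^+ l = tensmx (shift_mx k m) (1%:M : 'M_l).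
Proof.
rewrite shift_mxX; apply/matrixP=> i j.
case: (mxtens_indexP i) (mxtens_indexP j) => a i'; case=> b j'.
rewrite tensmxE !mxE /= addnAC -mulSnr -natrM mulnb; congr ((_ : bool)%:R).
by rewrite eq_addl_mul ?ltn_ord // xpair_eqE.
Qed.

Lemma block_diag_shift_comm m l (Z : 'M[k]_l) :
  let N := shift_mx k (m * l) ^+ l in
  block_diag m Z *m N = N *m block_diag m Z.
Proof. by rewrite /= shift_mx_tens block_diag_tens !tensmx_mul !mul1mx !mulmx1. Qed.

End BlockMatrices.

(** * The field generated by Z *)
Section GeneratedField.
Variables (k : fieldType) (l : nat) (Z : 'M[k]_l) (q : {poly k}).
Hypotheses (q_irr : irreducible_poly q) (l_gt0 : (0 < l)%N) (qZ : peval Z q = 0).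

Lemma peval_irred_unit r : ~~ (q %| r) -> exists b, peval Z r *m peval Z b = 1%:M.
Proof.
rewrite -irreducible_poly_coprime // => /coprimep_inv_mod[b /dvdpP[s rb]]; exists b.
by rewrite -pevalM -[r * b](subrK 1) rb rmorphD rmorphM /= qZ mulr0 add0r peval1.
Qed.

Lemma peval_irred_eq0 r : (peval Z r == 0) = (q %| r).
Proof.
apply/idP/idP=> [/eqP Zr0 | /dvdpP[s ->]]; last by rewrite rmorphM /= qZ mulr0.
apply: contraT => /peval_irred_unit[b]; rewrite Zr0 mul0mx => /matrixP.
by move=> /(_ (Ordinal l_gt0) (Ordinal l_gt0))/eqP; rewrite !mxE eq_sym oner_eq0.
Qed.

(** Polynomials in Z are closed under inversion because q is irreducible; a
    non-invertible one is zero, and [invmx] fixes zero. *)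
Lemma gen_fieldP W : gen_field Z W <-> exists r, W = peval Z r.
Proof.
split=> [|[r ->]].
  elim=> {W}[a||A B _ [r ->] _ [s ->]|A _ [r ->]|A B _ [r ->] _ [s ->]|A _ [r ->]].
  - by exists a%:P; rewrite pevalC.
  - by exists 'X; rewrite pevalX.
  - by exists (r + s); rewrite rmorphD.
  - by exists (- r); rewrite rmorphN.
  - by exists (r * s); rewrite pevalM.
  case qr: (q %| r).
    have /eqP-> : peval Z r == 0 by rewrite peval_irred_eq0.
    exists 0; rewrite linear0 invmx_out // inE /= unitmxE.
    by case: (l) l_gt0 => // l' _; rewrite det0 unitr0.
  have [b rb] := peval_irred_unit (negbT qr); exists b.
  have [ru _] := mulmx1_unit rb.
  by apply: (can_inj (mulKmx ru)); rewrite mulmxV.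
elim/poly_ind: r => [|r c IHr].
  by rewrite linear0 -(raddf0 (@scalar_mx k l)); apply: gen_scalar.
rewrite rmorphD /= pevalM pevalC pevalX.
by apply: gen_add; [apply: gen_mul => //; apply: gen_Z | apply: gen_scalar].
Qed.
End GeneratedField.

(** * Endomorphisms and bilinear forms in a basis *)
Section MatricesInABasis.
Variables (k : fieldType) (V : vectType k) (n : nat) (X : n.-tuple V).
Hypothesis X_basis : basis_of fullv X.
Implicit Types (f g : 'End(V)) (M : 'M[k]_n) (B : V -> V -> k).

Let coordX v : v = \sum_i coord X i v *: X`_i.
Proof. exact: coord_basis X_basis (memvf v). Qed.

Let coord_sumX (c : 'I_n -> k) j : coord X j (\sum_i c i *: X`_i) = c j.
Proof. by rewrite coord_sum_free // (basis_free X_basis). Qed.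

Lemma lfun_mxE f (j : 'I_n) : f X`_j = \sum_i lfun_mx X f i j *: X`_i.
Proof. by rewrite [LHS]coordX; apply: eq_bigr => i _; rewrite mxE. Qed.

Lemma lfun_mx_unique f M :
  (forall j : 'I_n, f X`_j = \sum_i M i j *: X`_i) -> lfun_mx X f = M.
Proof. by move=> fX; apply/matrixP=> i j; rewrite mxE fX coord_sumX. Qed.

Lemma lfun_mx_inj : injective (lfun_mx X).
Proof.
move=> f g fg; apply/lfunP=> v; rewrite [v]coordX !linear_sum.
by apply: eq_bigr => j _; rewrite !linearZ /= !lfun_mxE fg.
Qed.

Lemma lfun_mx_surj M : exists f, lfun_mx X f = M.
Proof.
pose h v := \sum_i (\sum_j M i j * coord X j v) *: X`_i.
have lin_h : linear h.
  move=> a u v; rewrite scaler_sumr -big_split; apply: eq_bigr => i _ /=.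
  rewrite scalerA -scalerDl mulr_sumr -big_split /=; congr (_ *: _).
  by apply: eq_bigr => j _; rewrite linearP mulrDr mulrCA.
pose hL : {linear V -> V} := HB.pack h (GRing.isSemilinear.Build k V V _ h
  (GRing.semilinear_linear lin_h)).
exists (linfun hL); apply: lfun_mx_unique => j; rewrite lfunE /= /h.
apply: eq_bigr => i _; congr (_ *: _).
rewrite (bigD1 j) //= coord_free ?(basis_free X_basis) // eqxx mulr1.
rewrite big1 ?addr0 // => j' /negbTE j'j.
by rewrite coord_free ?(basis_free X_basis) // eq_sym j'j mulr0.
Qed.

Lemma lfun_mx_comp f g : lfun_mx X (f \o g)%VF = lfun_mx X f *m lfun_mx X g.
Proof.
apply: lfun_mx_unique => j; rewrite comp_lfunE lfun_mxE linear_sum.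
rewrite (eq_bigr (fun a => \sum_i (lfun_mx X g a j * lfun_mx X f i a) *: X`_i)).
  rewrite exchange_big; apply: eq_bigr => i _; rewrite mxE scaler_suml.
  by apply: eq_bigr => a _; rewrite mulrC.
move=> a _; rewrite linearZ /= lfun_mxE scaler_sumr.
by apply: eq_bigr => i _; rewrite scalerA.
Qed.

Lemma lfun_mx1 : lfun_mx X \1%VF = 1%:M.
Proof.
apply/matrixP=> i j; rewrite !mxE lfunE /= coord_free ?(basis_free X_basis) //.
by rewrite eq_sym.
Qed.

Lemma lfun_mx_is_linear : linear (lfun_mx X).
Proof.
by move=> a f g; apply/matrixP=> i j; rewrite !mxE add_lfunE scale_lfunE linearP.
Qed.
HB.instance Definition _ := GRing.isSemilinear.Build k 'End(V) 'M[k]_n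
  _ (lfun_mx X) (GRing.semilinear_linear lfun_mx_is_linear).

Lemma lfun_mx_horner f p : lfun_mx X (lfun_horner p f) = peval (lfun_mx X f) p.
Proof.
rewrite /lfun_horner linear_sum /=; apply: eq_bigr => i _; rewrite linearZ /=.
congr (_ *: _); elim: (i : nat) => [|j IHj]; first by rewrite lfun_mx1.
by rewrite iterS lfun_mx_comp IHj exprS.
Qed.

Lemma lfun_mx_unit f : lfun_mx X f \in unitmx <-> bijective f.
Proof.
split=> [fu | [g fK gK]].
  have [g gf] := lfun_mx_surj (invmx (lfun_mx X f)).
  exists g => v; rewrite -comp_lfunE.
    rewrite (_ : (g \o f)%VF = \1%VF) ?lfunE //; apply: lfun_mx_inj.
    by rewrite lfun_mx_comp lfun_mx1 gf mulVmx.
  rewrite (_ : (f \o g)%VF = \1%VF) ?lfunE //; apply: lfun_mx_inj.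
  by rewrite lfun_mx_comp lfun_mx1 gf mulmxV.
have : ((f^-1 \o f)%VF = \1%VF).
  by apply: lker0_compVf; apply/lker0P; apply: can_inj fK.
move/(congr1 (lfun_mx X)); rewrite lfun_mx_comp lfun_mx1.
by case/mulmx1_unit.
Qed.

Definition bilinear_form B :=
  (forall y, scalar (B^~ y)) /\ (forall x, scalar (B x)).

Lemma bilinear_sum B (b : bilinear_form B) x y :
  B x y = \sum_(i < n) \sum_(j < n) coord X i x * B X`_i X`_j * coord X j y.
Proof.
have sumL (c : 'I_n -> k) z : B (\sum_i c i *: X`_i) z = \sum_i c i * B X`_i z.
  have [bL _] := b.
  pose h : {scalar V} := HB.pack (B^~ z) (GRing.isSemilinear.Build k V k _ (B^~ z)
    (GRing.semilinear_linear (bL z))).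
  rewrite -[LHS]/(h _) linear_sum; apply: eq_bigr => i _; exact: linearZ.
have sumR (c : 'I_n -> k) z : B z (\sum_i c i *: X`_i) = \sum_i c i * B z X`_i.
  have [_ bR] := b.
  pose h : {scalar V} := HB.pack (B z) (GRing.isSemilinear.Build k V k _ (B z)
    (GRing.semilinear_linear (bR z))).
  rewrite -[LHS]/(h _) linear_sum; apply: eq_bigr => i _; exact: linearZ.
rewrite {1}[x]coordX sumL; apply: eq_bigr => i _.
rewrite {1}[y]coordX sumR mulr_sumr; apply: eq_bigr => j _.
by rewrite mulrCA mulrC.
Qed.

Lemma gram_inj B B' : bilinear_form B -> bilinear_form B' ->
  gram X B = gram X B' -> B =2 B'.
Proof.
move=> b b' /matrixP BB' x y; rewrite (bilinear_sum b) (bilinear_sum b').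
apply: eq_bigr => i _; apply: eq_bigr => j _.
by have := BB' i j; rewrite !mxE => ->.
Qed.

Lemma bilinear_form_comp B f g :
  bilinear_form B -> bilinear_form (fun x y => B (f x) (g y)).
Proof.
by move=> [bL bR]; split=> z a u v /=; rewrite linearP ?(bL, bR).
Qed.

Lemma gram_comp B f g : bilinear_form B ->
  gram X (fun x y => B (f x) (g y)) = (lfun_mx X f)^T *m gram X B *m lfun_mx X g.
Proof.
move=> b; apply/matrixP=> i j; rewrite mxE (bilinear_sum b) mxE exchange_big.
apply: eq_bigr => d _; rewrite mxE mulr_suml; apply: eq_bigr => c _.
by rewrite !mxE.
Qed.

Lemma form_of_gramE B f x y : bilinear_form B ->
  form_of_gram X (gram X B *m lfun_mx X f) x y = B x (f y).
Proof.
move=> b; have := bilinear_form_comp \1%VF f b; move/bilinear_sum => /(_ x y).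
rewrite lfunE /= => ->; apply: eq_bigr => i _; apply: eq_bigr => j _.
congr (_ * _ * _); have := gram_comp \1%VF f b.
by rewrite lfun_mx1 trmx1 mul1mx => <-; rewrite mxE lfunE.
Qed.

(** A vector in the kernel of the Gram matrix gives the coordinates of a vector
    orthogonal to everything. *)
Lemma gram_unit B : bilinear_form B -> (forall y, (forall x, B x y = 0) -> y = 0) ->
  gram X B \in unitmx.
Proof.
move=> b nd; rewrite -unitmx_tr -row_free_unit -kermx_eq0; apply/rowV0P => u.
move/sub_kermxP/(congr1 trmx); rewrite trmx_mul trmxK trmx0 => Bu.
have /(congr1 (fun v => \row_j coord X j v)) : \sum_j u 0 j *: X`_j = 0.
  apply: nd => x; rewrite (bilinear_sum b) big1 // => i _.
  rewrite (eq_bigr (fun j => coord X i x * (gram X B i j * u^T j 0))); last first.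
    by move=> j _; rewrite coord_sumX !mxE mulrA.
  rewrite -mulr_sumr; have /matrixP/(_ i 0) := Bu.
  by rewrite !mxE => ->; rewrite mulr0.
move=> /rowP u0; apply/rowP=> j; have := u0 j.
by rewrite !mxE coord_sumX linear0.
Qed.

End MatricesInABasis.

(** * Automorphisms of the sextuple of an endomorphism *)
Section HermitianForms.
Variables (k : fieldType) (V : vectType k).

Lemma hermitian_bilinear eps (B : {hermitian V for eps & idfun}) : bilinear_form B.
Proof.
split=> [z a u v | z a u v] /=; first by rewrite linearPl.
by rewrite linearPr.
Qed.

Lemma hermitianC eps (B : {hermitian V for eps & idfun}) u v :
  B u v = (-1) ^+ eps * B v u.
Proof. exact: hermC. Qed.

Lemma exists_hermitian (eps : bool) (B : V -> V -> k) : bilinear_form B ->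
    (forall u v, B u v = (-1) ^+ eps * B v u) ->
  exists B' : {hermitian V for eps & idfun}, B' =2 B.
Proof.
move=> [bL bR] sym.
pose B' : {hermitian V for eps & idfun} :=
  HB.pack B (@bilinear_isBilinear.Build k V V k *%R (idfun \; *%R) B (bL, bR))
    (@isHermitianSesquilinear.Build k V eps idfun B sym).
by exists B'.
Qed.

End HermitianForms.

Section Diagonal.
Variables (k : fieldType) (U : vectType k).

Definition diag3_fun (g : 'End(U)) (v : U * U * U) : U * U * U :=
  (g v.1.1, g v.1.2, g v.2).

Fact diag3_is_linear g : linear (diag3_fun g).
Proof. by move=> a u v; congr (_, _, _); rewrite /= linearP. Qed.
HB.instance Definition _ g := GRing.isSemilinear.Build k (U * U * U)%type
  (U * U * U)%type _ (diag3_fun g) (GRing.semilinear_linear (diag3_is_linear g)).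

Definition diag3 (g : 'End(U)) : 'End((U * U * U)%type) := linfun (diag3_fun g).

Lemma diag3E g x y z : diag3 g (x, y, z) = (g x, g y, g z).
Proof. by rewrite lfunE. Qed.

Lemma diag3_id v : diag3 \1%VF v = v.
Proof. by case: v => -[x y] z; rewrite diag3E !lfunE. Qed.

Lemma diag3_comp f g v : diag3 (f \o g)%VF v = diag3 f (diag3 g v).
Proof. by case: v => -[x y] z; rewrite !diag3E !comp_lfunE. Qed.

Lemma in123E (x y z : U) : (x, y, z) = in1 x + in2 y + in3 z.
Proof. by congr (_, _, _); rewrite /= ?add0r ?addr0. Qed.

Lemma bijective_inj (W : vectType k) (f : 'End(W)) : injective f -> bijective f.
Proof.
move=> /lker0P f0; exists (f^-1)%VF.
  exact: lker0_lfunK.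
exact: lker0_lfunVK.
Qed.

End Diagonal.

Section SextupleStructure.
Variables (k : fieldType) (U : vectType k) (eta : 'End(U)).
Local Notation S := (sextuple_of eta).
Local Notation UUU := (U * U * U)%type.

Let i0 : 'I_3 := @Ordinal 3 0 isT.
Let i1 : 'I_3 := @Ordinal 3 1 isT.
Let i2 : 'I_3 := @Ordinal 3 2 isT.

Lemma mem_limg (h : {linear U -> UUU}) v :
  v \in limg (linfun h) <-> exists x, v = h x.
Proof.
split=> [/memv_imgP[x _ ->]|[x ->]]; first by exists x; rewrite lfunE.
by rewrite -[h x]lfunE memv_img ?memvf.
Qed.

Lemma memI1 (v : UUU) : v \in sextI S i0 <-> (v.1.2 = 0 /\ v.2 = 0).
Proof.
rewrite /= /endI (tnth_nth 0%VS) /= mem_limg; split=> [[x ->] //|].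
by case: v => -[x y] z /= [-> ->]; exists x.
Qed.

Lemma memI2 (v : UUU) : v \in sextI S i1 <-> (v.1.1 = 0 /\ v.1.2 = 0).
Proof.
rewrite /= /endI (tnth_nth 0%VS) /= mem_limg; split=> [[x ->] //|].
by case: v => -[x y] z /= [-> ->]; exists z.
Qed.

Lemma memI3 (v : UUU) : v \in sextI S i2 <-> (v.1.1 = - eta v.1.2 /\ v.2 = - v.1.2).
Proof.
rewrite /= /endI (tnth_nth 0%VS) /= mem_limg; split=> [[x ->] //|].
by case: v => -[x y] z /= [-> ->]; exists y.
Qed.

Lemma memC1 (v : UUU) : v \in sextC S i0 <-> v.2 = 0.
Proof.
rewrite /= /endC (tnth_nth 0%VS) /=; split=> [/memv_addP[u /mem_limg[x ->]]|].
  by case=> w /mem_limg[y ->] -> /=; rewrite addr0.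
case: v => -[x y] z /= ->; apply/memv_addP; exists (in1 x).
  by apply/mem_limg; exists x.
exists (in2 y); first by apply/mem_limg; exists y.
by congr (_, _, _); rewrite /= ?add0r ?addr0.
Qed.

Lemma memC2 (v : UUU) : v \in sextC S i1 <-> v.1.1 = 0.
Proof.
rewrite /= /endC (tnth_nth 0%VS) /=; split=> [/memv_addP[u /mem_limg[x ->]]|].
  by case=> w /mem_limg[y ->] -> /=; rewrite addr0.
case: v => -[x y] z /= ->; apply/memv_addP; exists (in2 y).
  by apply/mem_limg; exists y.
exists (in3 z); first by apply/mem_limg; exists z.
by congr (_, _, _); rewrite /= ?add0r ?addr0.
Qed.

Lemma memC3 (v : UUU) : v \in sextC S i2 <-> v.1.1 + v.1.2 + v.2 = eta v.2.
Proof.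
rewrite /= /endC (tnth_nth 0%VS) /=; split=> [/memv_addP[u /mem_limg[x ->]]|].
  case=> w /mem_limg[y ->] -> /=; rewrite add0r linearN.
  by rewrite addrACA subrr add0r; apply: addrK.
case: v => -[x y] z /= def_v; apply/memv_addP; exists (inC3 (- (y + z))).
  by apply/mem_limg; exists (- (y + z)).
exists (inI3 eta (- z)); first by apply/mem_limg; exists (- z).
congr (_, _, _); rewrite /= ?linearN /= ?opprK ?add0r //.
  by rewrite -def_v -[x + y + z]addrA [RHS]addrC; apply/esym/addrK.
exact/esym/addrK.
Qed.

(** Each subspace is defined by equations that the diagonal action of g
    preserves; equality of the image follows by counting dimensions. *)
Lemma diag3_sext_aut (g : 'End(U)) : bijective g -> (eta \o g = g \o eta)%VF ->
  sext_aut S (diag3 g).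
Proof.
move=> g_bij /lfunP eg; have ge x : eta (g x) = g (eta x).
  by have := eg x; rewrite !comp_lfunE.
have bij : bijective (diag3 g).
  apply: bijective_inj => -[[x y] z] [[x' y'] z']; rewrite !diag3E.
  by case=> /(bij_inj g_bij)-> /(bij_inj g_bij)-> /(bij_inj g_bij)->.
have sub (W : {vspace UUU}) : (forall v, v \in W -> diag3 g v \in W) ->
    (diag3 g @: W)%VS = W.
  move=> gW; apply/eqP; rewrite eqEdim limg_dim_eq; last first.
    by apply/eqP; rewrite (eqP (introT lker0P (bij_inj bij))) capv0.
  by rewrite leqnn andbT; apply/subvP=> _ /memv_imgP[v vW ->]; apply: gW.
split=> // -[[|[|[|//]]] lti]; rewrite (bool_irrelevance lti isT); apply: sub.
- by move=> [[x y] z]; rewrite diag3E !memI1 /= => -[-> ->]; rewrite linear0.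
- by move=> [[x y] z]; rewrite diag3E !memI2 /= => -[-> ->]; rewrite linear0.
- by move=> [[x y] z]; rewrite diag3E !memI3 /= => -[-> ->]; rewrite ge !linearN.
- by move=> [[x y] z]; rewrite diag3E !memC1 /= => ->; rewrite linear0.
- by move=> [[x y] z]; rewrite diag3E !memC2 /= => ->; rewrite linear0.
by move=> [[x y] z]; rewrite diag3E !memC3 /= => def; rewrite ge -def !linearD.
Qed.

(** C_1 and C_2 meet in the middle copy of U, so f is block diagonal with blocks
    a, b, c.  The vectors (x,-x,0) of C_3 give a = b, and the vectors
    (-eta x, x, -x) of I_3 give b = c and a eta = eta b. *)
Lemma sext_aut_diag3 (f : 'End(UUU)) : sext_aut S f ->
  exists g : 'End(U), [/\ bijective g, (eta \o g = g \o eta)%VF & f = diag3 g].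
Proof.
move=> [f_bij fI fC].
have memI i v : v \in sextI S i -> f v \in sextI S i.
  by move=> vI; rewrite -fI memv_img.
have memC i v : v \in sextC S i -> f v \in sextC S i.
  by move=> vC; rewrite -fC memv_img.
pose a x := (f (in1 x)).1.1; pose b y := (f (in2 y)).1.2.
pose c z := (f (in3 z)).2.
have f1 x : f (in1 x) = (a x, 0, 0).
  have /memI/memI1 : in1 x \in sextI S i0 by apply/memI1.
  by rewrite /a; case: (f _) => -[? ?] ? /= [-> ->].
have f2 y : f (in2 y) = (0, b y, 0).
  have /memC/memC1 : in2 y \in sextC S i0 by apply/memC1.
  have /memC/memC2 : in2 y \in sextC S i1 by apply/memC2.
  by rewrite /b; case: (f _) => -[? ?] ? /= -> ->.
have f3 z : f (in3 z) = (0, 0, c z).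
  have /memI/memI2 : in3 z \in sextI S i1 by apply/memI2.
  by rewrite /c; case: (f _) => -[? ?] ? /= [-> ->].
have fE x y z : f (x, y, z) = (a x, b y, c z).
  rewrite in123E !linearD /= f1 f2 f3.
  by congr (_, _, _); rewrite /= ?add0r ?addr0.
have lin_a : linear a by move=> s x y; rewrite /a linearP linearP.
pose aL : {linear U -> U} := HB.pack a (GRing.isSemilinear.Build k U U _ a
  (GRing.semilinear_linear lin_a)).
have b_opp x : b (- x) = - b x by rewrite /b linearN linearN.
have c_opp x : c (- x) = - c x by rewrite /c linearN linearN.
have a_opp x : a (- x) = - a x by rewrite /a linearN linearN.
have ab x : a x = b x.
  have xC : (x, - x, 0) \in sextC S i2 by apply/memC3; rewrite /= subrr linear0 addr0.
  have /memC3 := memC _ _ xC; rewrite fE /= b_opp.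
  have -> : c 0 = 0 by rewrite /c linear0 linear0.
  by rewrite linear0 addr0 => /eqP; rewrite subr_eq0 => /eqP.
have xI x : (- eta x, x, - x) \in sextI S i2 by apply/memI3.
have bc x : c x = b x.
  have /memI3 := memI _ _ (xI x); rewrite fE /= c_opp => -[_].
  exact: oppr_inj.
have ae x : a (eta x) = eta (a x).
  have /memI3 := memI _ _ (xI x); rewrite fE /= a_opp => -[+ _].
  by rewrite -ab; apply: oppr_inj.
exists (linfun aL); split.
- apply: bijective_inj => x y; rewrite !lfunE /= => axy.
  have : in1 x = in1 y by apply: (bij_inj f_bij); rewrite !f1 axy.
  by case.
- by apply/lfunP=> x; rewrite !comp_lfunE !lfunE /= ae.
apply/lfunP=> -[[x y] z]; rewrite fE diag3E !lfunE /=.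
by rewrite !ab bc.
Qed.
End SextupleStructure.

(** * Compatible forms and their middle block *)
Section CompatibleForms.
Variables (k : fieldType) (U : vectType k) (eta : 'End(U)).
Local Notation S := (sextuple_of eta).
Local Notation UUU := (U * U * U)%type.
Implicit Types eps : bool.

(** The restriction to the middle copy of U, which carries all the information
    on a compatible form. *)
Definition middle (B : UUU -> UUU -> k) (x y : U) : k := B (in2 x) (in2 y).

Lemma compatible_orth eps (B : {hermitian UUU for eps & idfun}) i u v :
  compatible S B -> u \in sextC S i -> v \in sextI S i -> B u v = 0.
Proof. by case=> _ ->; move=> /mem_orthovP; apply. Qed.

Lemma middle_bilinear (B : UUU -> UUU -> k) :
  bilinear_form B -> bilinear_form (middle B).
Proof. by move=> [bL bR]; split=> z a u v; rewrite /middle /= linearP ?(bL, bR). Qed.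

Section OneForm.
Variables (eps : bool) (B : {hermitian UUU for eps & idfun}).
Hypothesis B_comp : compatible S B.
Local Notation Q := (middle B).

Let i0 : 'I_3 := @Ordinal 3 0 isT.
Let i1 : 'I_3 := @Ordinal 3 1 isT.
Let i2 : 'I_3 := @Ordinal 3 2 isT.

Let B11 x y : B (in1 x) (in1 y) = 0.
Proof. by apply: (compatible_orth (i := i0) B_comp); [apply/memC1|apply/memI1]. Qed.
Let B21 x y : B (in2 x) (in1 y) = 0.
Proof. by apply: (compatible_orth (i := i0) B_comp); [apply/memC1|apply/memI1]. Qed.
Let B33 x y : B (in3 x) (in3 y) = 0.
Proof. by apply: (compatible_orth (i := i1) B_comp); [apply/memC2|apply/memI2]. Qed.
Let B23 x y : B (in2 x) (in3 y) = 0.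
Proof. by apply: (compatible_orth (i := i1) B_comp); [apply/memC2|apply/memI2]. Qed.
Let B12 x y : B (in1 x) (in2 y) = 0.
Proof. by rewrite hermitianC B21 mulr0. Qed.
Let B32 x y : B (in3 x) (in2 y) = 0.
Proof. by rewrite hermitianC B23 mulr0. Qed.

Lemma middleC x y : Q x y = (-1) ^+ eps * Q y x.
Proof. exact: hermitianC. Qed.

Let expand x1 x2 x3 y1 y2 y3 : B (x1, x2, x3) (y1, y2, y3) =
  B (in1 x1) (in3 y3) + Q x2 y2 + B (in3 x3) (in1 y1).
Proof.
rewrite !in123E !linearDl !linearDr /= B11 B12 B21 B23 B32 B33.
by rewrite !addr0 !add0r.
Qed.

Let B13 x y : B (in1 x) (in3 y) = - Q x y.
Proof.
have uC : (x, - x, 0) \in sextC S i2.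
  by apply/memC3; rewrite /= subrr linear0 addr0.
have vI : (- eta (- y), - y, - - y) \in sextI S i2 by apply/memI3.
have := compatible_orth B_comp uC vI; rewrite expand opprK.
have -> : in3 (0 : U) = 0 by [].
rewrite linear0l addr0 => /eqP; rewrite addr_eq0 => /eqP->; congr (- _).
have [_ bR] := middle_bilinear (hermitian_bilinear B).
by rewrite /middle ![in2 (- _)]linearN linearNl linearNr opprK.
Qed.

Let B31 x y : B (in3 x) (in1 y) = - Q x y.
Proof. by rewrite hermitianC B13 mulrN -middleC. Qed.

(** Orthogonality of I_1 to C_1 and of I_2 to C_2 leaves the blocks (1,3),
    (2,2), (3,1); that of I_3 to the vectors (x,-x,0) of C_3 relates them. *)
Lemma compatibleE x1 x2 x3 y1 y2 y3 :
  B (x1, x2, x3) (y1, y2, y3) = Q x2 y2 - Q x1 y3 - Q x3 y1.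
Proof. by rewrite expand B13 B31 [- _ + _]addrC. Qed.

(** This is the isotropy of I_3. *)
Lemma middle_eta x y : Q (eta x) y + Q x (eta y) = Q x y.
Proof.
have uC : (- eta x, x, - x) \in sextC S i2.
  by apply/memC3; rewrite /= linearN addrK.
have vI : (- eta y, y, - y) \in sextI S i2 by apply/memI3.
have := compatible_orth B_comp uC vI; rewrite compatibleE.
have QN u v : Q (- u) (- v) = Q u v.
  by rewrite /middle ![in2 (- _)]linearN linearNl linearNr opprK.
by rewrite !QN -addrA -opprD => /eqP; rewrite subr_eq0 => /eqP->.
Qed.

Lemma middle_nondegenerate y : (forall x, Q x y = 0) -> y = 0.
Proof.
move=> Qy; have [/eqP nd _] := B_comp.
have : in2 y \in orthov B fullv.
  apply/mem_orthovP => -[[u v] w] _.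
  have QX0 x : Q x 0 = 0 by rewrite /middle !linear0.
  by rewrite hermitianC /= compatibleE !QX0 Qy !subr0 mulr0.
by rewrite nd memv0 => /eqP[].
Qed.

End OneForm.

Lemma compatible_pullback eps (B B' : {hermitian UUU for eps & idfun}) f :
  compatible S B -> sext_aut S f -> (forall u v, B' u v = B (f u) (f v)) ->
  compatible S B'.
Proof.
move=> [/eqP nd BC] [f_bij fI fC] B'E; have [g fK gK] := f_bij.
have orthE (W : {vspace UUU}) u :
    (u \in orthov B' W) = (f u \in orthov B (f @: W)%VS).
  apply/mem_orthovP/mem_orthovP => [uW _ /memv_imgP[v vW ->] | uW v vW].
    by rewrite -B'E uW.
  by rewrite B'E uW // memv_img.
split.
  apply/eqP/vspaceP => u; rewrite orthE.
  have -> : (f @: fullv)%VS = fullv.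
    by apply/vspaceP=> v; rewrite memvf -[v]gK memv_img ?memvf.
  rewrite nd !memv0; apply/eqP/eqP=> [|->]; last by rewrite linear0.
  by move=> fu0; apply: (can_inj fK); rewrite fu0 linear0.
move=> i; apply/vspaceP=> u; rewrite orthE fI -BC -{2}(fC i).
apply/idP/idP=> [uC|/memv_imgP[v vC /(can_inj fK)->]] //.
exact: memv_img.
Qed.

End CompatibleForms.

(** * Matrices in the frame basis *)
Section BlockEndomorphisms.
Variables (k : fieldType) (V : vectType k) (n l : nat) (T : (n * l).-tuple V).
Hypothesis T_basis : basis_of fullv T.

Lemma sum_block_diag (W : 'M[k]_l) (b : 'I_n) (j : 'I_l) :
  \sum_i block_diag n W i (mxtens_index (b, j)) *: T`_i =
  \sum_i W i j *: T`_(mxtens_index (b, i)).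
Proof.
rewrite (reindex (@mxtens_index n l)) /=; last first.
  by exists (@mxtens_unindex n l) => x _; rewrite (mxtens_indexK, mxtens_unindexK).
rewrite (eq_bigr (fun p => ((p.1 == b)%:R * W p.2 j) *: T`_(mxtens_index (p.1, p.2)))).
  rewrite -(pair_bigA _ (fun c d =>
    ((c == b)%:R * W d j) *: T`_(mxtens_index (c, d)))) /= (bigD1 b) //=.
  rewrite [X in _ + X]big1 ?addr0 => [|c /negbTE->].
    by apply: eq_bigr => d _; rewrite eqxx mul1r.
  by rewrite big1 // => d _; rewrite mul0r scale0r.
by case=> c d _; rewrite block_diagE.
Qed.

Lemma lfun_mx_block_diag (f : 'End(V)) W : lfun_mx T f = block_diag n W <->
  forall (b : 'I_n) (j : 'I_l),
    f T`_(mxtens_index (b, j)) = \sum_i W i j *: T`_(mxtens_index (b, i)).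
Proof.
split=> [fW b j | fT]; first by rewrite (lfun_mxE T_basis) fW sum_block_diag.
apply: lfun_mx_unique => // p; case: (mxtens_indexP p) => b j.
by rewrite sum_block_diag fT.
Qed.

End BlockEndomorphisms.

Section Frame.
Variables (k : fieldType) (U : vectType k) (m l : nat) (X : (m * l).-tuple U).
Hypothesis X_basis : basis_of fullv X.

Lemma frame_basis : basis_of fullv (frame X).
Proof.
rewrite basisEdim size_tuple; apply/andP; split.
  apply/subvP=> -[[x y] z] _; rewrite in123E.
  have sub (h : {linear U -> (U * U * U)%type}) x0 :
      {subset map h X <= (frame X : seq _)} -> h x0 \in <<frame X>>%VS.
    move=> hX; rewrite (coord_basis X_basis (memvf x0)) linear_sum.
    apply: memv_suml => i _; rewrite linearZ memvZ // memv_span // hX //.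
    by rewrite map_f // mem_nth // size_tuple.
  by rewrite !memvD // sub // => v; rewrite !mem_cat => ->; rewrite ?orbT.
have := size_basis X_basis; rewrite dimvf => dimU.
rewrite dimvf (_ : dim _ = dim U + dim U + dim U)%N // dimU.
by rewrite -mulnA mulSn mul2n -addnn addnA.
Qed.

(** The frame lists the images of X under the three embeddings, so the blocks of
    length l of the frame are the images of those of X. *)
Lemma lfun_mx_frame_diag3 g W : lfun_mx X g = block_diag m W ->
  lfun_mx (frame X) (diag3 g) = block_diag (3 * m) W.
Proof.
move/(lfun_mx_block_diag X_basis) => gX.
apply/(lfun_mx_block_diag frame_basis) => p j.
case: (mxtens_indexP p) => c b.
have frameE (i : 'I_l) : (frame X)`_(mxtens_index (mxtens_index (c, b), i)) =
    nth (@in1 k U) [:: @in1 k U; @in2 k U; @in3 k U] c X`_(mxtens_index (b, i)).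
  have nthX (h : U -> (U * U * U)%type) :
      (map h X)`_(mxtens_index (b, i)) = h X`_(mxtens_index (b, i)).
    by rewrite (nth_map 0) // size_tuple ltn_ord.
  (* i-th vector of the b-th block of the c-th copy of X *)
  have idx : ((c * m + b) * l + i = c * (m * l) + mxtens_index (b, i))%N.
    by rewrite /= mulnDl mulnA addnA.
  rewrite /= idx !nth_cat !size_map size_tuple.
  have := ltn_ord (mxtens_index (b, i)).
  case: c {idx} => [[|[|[|//]]] ltc] lt_i; cbn [nth nat_of_ord].
  - by rewrite mul0n add0n lt_i nthX.
  - by rewrite mul1n ltnNge leq_addr /= addKn lt_i nthX.
  rewrite mul2n -addnn -addnA ltnNge leq_addr /= addKn ltnNge leq_addr /=.
  by rewrite addKn nthX.
rewrite frameE (eq_bigr _ (fun i _ => congr1 _ (frameE i))).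
have diag_in (h : {linear U -> (U * U * U)%type}) :
    (forall x, diag3 g (h x) = h (g x)) ->
    diag3 g (h X`_(mxtens_index (b, j))) =
      \sum_i W i j *: h X`_(mxtens_index (b, i)).
  move=> ->; rewrite gX linear_sum; apply: eq_bigr => i _; exact: linearZ.
by case: c {frameE} => [[|[|[|//]]] ltc]; apply: diag_in => x; rewrite diag3E ?linear0.
Qed.
End Frame.

(** * From the sextuple to its middle block *)
Section Transfer.
Variables (k : fieldType) (U : vectType k) (eta : 'End(U)).
Variables (m l : nat) (X : (m * l).-tuple U).
Hypothesis X_basis : basis_of fullv X.
Local Notation UUU := (U * U * U)%type.
Local Notation S := (sextuple_of eta).

Lemma diag3_aut_of_mx (g : 'End(U)) : lfun_mx X g \in unitmx ->
    lfun_mx X g *m lfun_mx X eta = lfun_mx X eta *m lfun_mx X g ->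
  sext_aut S (diag3 g).
Proof.
move=> gu ge; apply: diag3_sext_aut; first exact/(lfun_mx_unit X_basis).
by apply: (lfun_mx_inj X_basis); rewrite !(lfun_mx_comp X_basis) ge.
Qed.

(** Both sides of an identity between compatible forms twisted by diagonal
    endomorphisms are recovered from their middle blocks by [compatibleE]. *)
Lemma diag3_gramP eps eps' (B : {hermitian UUU for eps & idfun})
    (B' : {hermitian UUU for eps' & idfun}) (f g f' g' : 'End(U)) :
    compatible S B -> compatible S B' ->
  (forall u v, B (diag3 f u) (diag3 g v) = B' (diag3 f' u) (diag3 g' v)) <->
  (lfun_mx X f)^T *m gram X (middle B) *m lfun_mx X g =
  (lfun_mx X f')^T *m gram X (middle B') *m lfun_mx X g'.
Proof.
move=> Bc B'c.
have b := middle_bilinear (hermitian_bilinear B).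
have b' := middle_bilinear (hermitian_bilinear B').
rewrite -(gram_comp X_basis f g b) -(gram_comp X_basis f' g' b').
split=> [BB' | /(gram_inj X_basis (bilinear_form_comp f g b)
                   (bilinear_form_comp f' g' b')) BB' [[x y] z] [[x' y'] z']].
  apply/matrixP=> i j; rewrite !mxE.
  have := BB' (in2 X`_i) (in2 X`_j); rewrite !diag3E !linear0.
  exact.
by rewrite !diag3E (compatibleE Bc) (compatibleE B'c) !BB'.
Qed.

Lemma middle_gram_eta eps (B : {hermitian UUU for eps & idfun}) : compatible S B ->
  (lfun_mx X eta)^T *m gram X (middle B) =
  gram X (middle B) *m (1%:M - lfun_mx X eta).
Proof.
move=> Bc; have b := middle_bilinear (hermitian_bilinear B).
apply/eqP; rewrite mulmxBr mulmx1 -subr_eq opprK; apply/eqP/matrixP=> i j.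
have /matrixP/(_ i j) := gram_comp X_basis eta \1%VF b.
have /matrixP/(_ i j) := gram_comp X_basis \1%VF eta b.
rewrite (lfun_mx1 X_basis) trmx1 mul1mx mulmx1 !mxE !lfunE /= => <- <-.
exact: middle_eta.
Qed.

Lemma middle_gram_tr eps (B : {hermitian UUU for eps & idfun}) :
  gram X (middle B) = (-1) ^+ eps *: (gram X (middle B))^T.
Proof. by apply/matrixP=> i j; rewrite !mxE middleC. Qed.

Lemma middle_gram_unit eps (B : {hermitian UUU for eps & idfun}) :
  compatible S B -> gram X (middle B) \in unitmx.
Proof.
move=> Bc; apply: gram_unit (middle_bilinear (hermitian_bilinear B)) _ => //.
exact: middle_nondegenerate Bc.
Qed.

Section OneForm.
Variables (eps : bool) (B : {hermitian UUU for eps & idfun}).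
Hypothesis B_comp : compatible S B.
Local Notation H := (gram (frame X) B).
Local Notation Q := (gram X (middle B)).

Lemma form_block_mulr W w u v : lfun_mx X w = block_diag m W ->
  form_of_gram (frame X) (block_mulr H W) u v = B u (diag3 w v).
Proof.
move=> wW; have := lfun_mx_frame_diag3 X_basis wW.
rewrite (block_mulrE (n := 3 * m)) => <-.
by rewrite (form_of_gramE (frame_basis X_basis)) //; exact: hermitian_bilinear.
Qed.

(** W' = W describes F^+, and W' = - W describes F^-. *)
Lemma block_adjointP W W' :
  block_mull W^T H = block_mulr H W' <->
  (block_diag m W)^T *m Q = Q *m block_diag m W'.
Proof.
have [w wW] := lfun_mx_surj X_basis (block_diag m W).
have [w' wW'] := lfun_mx_surj X_basis (block_diag m W').
have b := hermitian_bilinear B; have Fb := frame_basis X_basis.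
rewrite (block_mulrE (n := 3 * m)) (block_mullE (n := 3 * m)) -tr_block_diag.
rewrite -(lfun_mx_frame_diag3 X_basis wW) -(lfun_mx_frame_diag3 X_basis wW').
have := gram_comp Fb (diag3 w) \1%VF b; have := gram_comp Fb \1%VF (diag3 w') b.
rewrite (lfun_mx1 Fb) trmx1 mul1mx mulmx1 => <- <-.
have := diag3_gramP w \1%VF \1%VF w' B_comp B_comp.
rewrite (lfun_mx1 X_basis) trmx1 mul1mx mulmx1 wW wW' => <-.
split=> [/(gram_inj Fb (bilinear_form_comp _ _ b) (bilinear_form_comp _ _ b)) E u v|E].
  by have := E u v; rewrite !id_lfunE !diag3_id.
apply/matrixP=> i j; rewrite !mxE !id_lfunE.
by have := E (frame X)`_i (frame X)`_j; rewrite !diag3_id.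
Qed.

End OneForm.
End Transfer.

(** The remainder of r modulo p is killed by A whenever r is. *)
Lemma minpoly_dvdp (k : fieldType) n (A : 'M[k]_n) p : p != 0 -> peval A p = 0 ->
    (forall r, r != 0 -> peval A r = 0 -> (size p <= size r)%N) ->
  forall r, (p %| r) = (peval A r == 0).
Proof.
move=> p0 Ap pmin r; apply/idP/eqP=> [/dvdpP[s ->]|Ar].
  by rewrite rmorphM /= Ap mulr0.
rewrite /dvdp; apply/idPn => nz; have := ltn_modp r p; rewrite p0 ltnNge pmin //.
by have := Ar; rewrite {1}(divp_eq r p) rmorphD rmorphM /= Ap mulr0 add0r.
Qed.

(** * Isometry classes of compatible forms *)
Theorem theorem8p17 (k : fieldType) (k_perfect : perfect_field k)
    (k_char : 2%N \notin [pchar k])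
    (U : vectType k) (eta : 'End(U))
    (eta_indec : indecomposable eta)
    (eta_noeig : forall a : k, ~~ passmx.leigenvalue eta a)
    (S_sd : self_dual (sextuple_of eta))
    (q : {poly k}) (m l : nat)
    (q_irr : irreducible_poly q)
    (q_minpoly : is_minpoly eta (q ^+ m))
    (q_deg : size q = l.+1)
    (eps1 eps2 : bool)
    (B1 : {hermitian (U * U * U)%type for eps1 & idfun})
    (B2 : {hermitian (U * U * U)%type for eps2 & idfun})
    (B1_comp : compatible (sextuple_of eta) B1)
    (B2_comp : compatible (sextuple_of eta) B2)
    (X : (m * l).-tuple U) (X_basis : basis_of fullv X)
    (Z : 'M[k]_l) (Z_char : char_poly Z = q)
    (eta_mx : lfun_mx X eta = block_diag m Z + shift_mx k (m * l) ^+ l) :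
  let H1 := gram (frame X) B1 in
  let eps := sign_of eps1 * sign_of eps2 in
  (eps = 1 ->
     exists (Z' : 'M[k]_l) (eps' : bool)
            (B' : {hermitian (U * U * U)%type for eps' & idfun})
            (f : 'End((U * U * U)%type)),
       [/\ Z' != 0, Fplus Z H1 Z',
           B' =2 form_of_gram (frame X) (block_mulr H1 Z'),
           compatible (sextuple_of eta) B' &
           sext_aut (sextuple_of eta) f /\ is_isometry B2 B' f])
  /\
  (forall K : 'M[k]_l, gen_field Z K -> K != 0 ->
     (exists f : 'End((U * U * U)%type),
        sext_aut (sextuple_of eta) f /\
        is_isometry B1 (form_of_gram (frame X) (block_mulr H1 K)) f)
     <->
     (exists X1 Y1 : 'M[k]_l,
        [/\ Fplus Z H1 X1, Fminus Z H1 Y1 &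
            K = X1 *m X1 - Y1 *m Y1])).
Proof.
have X_size := size_basis X_basis.
have [Unz _] := eta_indec.
have [l_gt0 m_gt0] : (0 < l)%N /\ (0 < m)%N.
  have : (0 < m * l)%N by rewrite -X_size lt0n dimv_eq0.
  by rewrite muln_gt0 => /andP[].
case: m m_gt0 q_minpoly X X_basis eta_mx X_size
  => // m' _ {}q_minpoly {}X {}X_basis {}eta_mx _.
move=> H1 eps.
(* E is the matrix of eta, D its semisimple part; Q1 and Q2 are the Gram
   matrices of the middle blocks. *)
set E := lfun_mx X eta in eta_mx; set D := block_diag m'.+1 Z in eta_mx.
pose Q1 := gram X (middle B1); pose Q2 := gram X (middle B2).
have q_neq0 := irredp_neq0 q_irr.
have q_sep := k_perfect _ q_irr.
have qZ : peval Z q = 0 by rewrite -Z_char peval_char_poly.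
have pD r : peval D r = block_diag m'.+1 (peval Z r) by rewrite peval_block_diag.
have qD : peval D q = 0 by rewrite pD qZ linear0.
have DN := block_diag_shift_comm m'.+1 Z.
have DE : D *m E = E *m D by rewrite eta_mx mulmxDl mulmxDr DN.
have nilED : (E - D) ^+ m'.+1 = 0 by rewrite eta_mx addrC addKr shift_mx_nilp.
have size_qm : size (q ^+ m'.+1) = (m'.+1 * l).+1.
  have := size_exp q m'.+1; rewrite q_deg mulnC => <-.
  by rewrite prednK // lt0n size_poly_eq0 expf_neq0.
have minE r : (q ^+ m'.+1 %| r) = (peval E r == 0).
  have [_ qE qmin] := q_minpoly.
  apply: minpoly_dvdp => [||s s0 Es]; first by rewrite expf_neq0.
    by rewrite -(lfun_mx_horner X_basis) qE linear0.
  apply: qmin => //; apply: (lfun_mx_inj X_basis).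
  by rewrite (lfun_mx_horner X_basis) Es linear0.
have Q1u : Q1 \in unitmx := middle_gram_unit X_basis B1_comp.
have Q2u : Q2 \in unitmx := middle_gram_unit X_basis B2_comp.
have EQ1 : E^T *m Q1 = Q1 *m (1%:M - E) := middle_gram_eta X_basis B1_comp.
have EQ2 : E^T *m Q2 = Q2 *m (1%:M - E) := middle_gram_eta X_basis B2_comp.
have adjP (W W' : 'M_l) : block_mull W^T H1 = block_mulr H1 W' <->
    (block_diag m'.+1 W)^T *m Q1 = Q1 *m block_diag m'.+1 W'.
  exact (block_adjointP X_basis B1_comp W W').
have DQ r : (peval D r)^T *m Q1 = Q1 *m peval D (reflect_poly r).
  exact: (peval_adjoint_semisimple q_irr q_sep minE size_qm DE qD nilED Q1u EQ1).
have FZ := gen_fieldP q_irr l_gt0 qZ.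
have Z0 := peval_irred_eq0 q_irr l_gt0 qZ.
have commE g : (eta \o g = g \o eta)%VF <-> lfun_mx X g *m E = E *m lfun_mx X g.
  rewrite -!(lfun_mx_comp X_basis); split=> [->//|eg].
  by apply: (lfun_mx_inj X_basis); rewrite eg.
split.
  (* Equal symmetry makes C = Q1^-1 Q2 self-adjoint for Q1. *)
  move=> eps1E; have {eps1E} eps12 : eps2 = eps1.
    by move: eps1E; rewrite /eps; case: (eps1) (eps2) => [] [].
  subst eps2; pose s : k := (-1) ^+ eps1.
  have Q1s : Q1 = s *: Q1^T := middle_gram_tr X B1.
  have Q2s : Q2 = s *: Q2^T := middle_gram_tr X B2.
  have [C QC] : exists C, Q1 *m C = Q2 by exists (invmx Q1 *m Q2); rewrite mulKVmx.
  have Cu : C \in unitmx by move: Q2u; rewrite -QC unitmx_mul => /andP[].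
  have CE : C *m E = E *m C by apply: adjoint_quotient_comm EQ1 _; rewrite ?QC.
  have CQ : C^T *m Q1 = Q1 *m C.
    by rewrite {1}Q1s -scalemxAr -trmx_mul QC -Q2s.
  have [r [S [qr rQ SE Su SQ]]] := selfadjoint_scalar_times_square q_irr q_sep
    minE size_qm DE qD nilED Q1u EQ1 k_char Cu CE CQ.
  have [g gS] := lfun_mx_surj X_basis S.
  have [h hS] := lfun_mx_surj X_basis (invmx S).
  have [z zr] := lfun_mx_surj X_basis (peval D r).
  have gh : (g \o h)%VF = \1%VF.
    apply: (lfun_mx_inj X_basis).
    by rewrite (lfun_mx_comp X_basis) (lfun_mx1 X_basis) gS hS mulmxV.
  have ghv v : diag3 g (diag3 h v) = v.
    by rewrite -diag3_comp gh diag3_id.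
  have g_aut : sext_aut (sextuple_of eta) (diag3 g).
    by apply: (diag3_aut_of_mx X_basis); rewrite gS.
  have h_aut : sext_aut (sextuple_of eta) (diag3 h).
    by apply: (diag3_aut_of_mx X_basis); rewrite hS ?unitmx_inv // comm_invmx.
  have zP u v : B1 (diag3 z u) v = B1 u (diag3 z v).
    have [_ /(_ _ u v)] := diag3_gramP X_basis z \1%VF \1%VF z B1_comp B1_comp.
    by rewrite !diag3_id; apply; rewrite (lfun_mx1 X_basis) trmx1 mul1mx mulmx1 zr.
  have zB u v : B1 (diag3 g u) (diag3 z (diag3 g v)) = B2 u v.
    have [_ /(_ _ u v)] := diag3_gramP X_basis g (z \o g)%VF \1%VF \1%VF B1_comp B2_comp.
    rewrite !diag3_id diag3_comp; apply; rewrite (lfun_mx1 X_basis) trmx1 mul1mx mulmx1.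
    by rewrite (lfun_mx_comp X_basis) gS zr !mulmxA SQ QC.
  (* z is self-adjoint for B1, so B1(u, z v) has the symmetry of B1; it is the
     transport of B2 by the automorphism g, which makes it compatible. *)
  have [|u v|B' B'E] := @exists_hermitian _ _ eps1 (fun u v => B1 u (diag3 z v)).
  - have := bilinear_form_comp \1%VF (diag3 z) (hermitian_bilinear B1).
    case=> bL bR; split=> y a u v.
      by have := bL y a u v; rewrite /= !id_lfunE.
    by have := bR y a u v; rewrite /= !id_lfunE.
  - by rewrite -zP hermitianC.
  exists (peval Z r), eps1, B', (diag3 g); split.
  - by rewrite Z0.
  - by split; [apply/FZ; exists r|apply/adjP; rewrite -pD].
  - by move=> u v; rewrite B'E (form_block_mulr X_basis B1 (w := z)) ?zr ?pD.
  - apply: (compatible_pullback B2_comp h_aut) => u v.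
    by rewrite B'E -zB !ghv.
  by split=> //; split; [case: g_aut|move=> u v; rewrite B'E zB].
move=> K /FZ[r defK] Knz; have [z zr] := lfun_mx_surj X_basis (peval D r).
have zE u v : form_of_gram (frame X) (block_mulr H1 K) u v = B1 u (diag3 z v).
  by rewrite (form_block_mulr X_basis B1 (w := z)) ?zr ?pD ?defK.
have isoP g : (forall u v, form_of_gram (frame X) (block_mulr H1 K)
      (diag3 g u) (diag3 g v) = B1 u v) <->
    (lfun_mx X g)^T *m Q1 *m peval D r *m lfun_mx X g = Q1.
  have := diag3_gramP X_basis g (z \o g)%VF \1%VF \1%VF B1_comp B1_comp.
  rewrite (lfun_mx1 X_basis) trmx1 mul1mx mulmx1 (lfun_mx_comp X_basis) zr !mulmxA => <-.
  by split=> E0 u v; have := E0 u v; rewrite zE diag3_comp !diag3_id.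
have half : (2%:R : k) != 0 by apply: contra k_char; rewrite inE.
split.
  case=> f [/sext_aut_diag3[g [g_bij /commE gE ->]] [_ /isoP gQ]].
  have [h qh] := scaled_isometry_norm q_irr minE size_qm DE qD nilED Q1u EQ1 gE gQ.
  (* X = (h + h')/2 and Y = (h - h')/2, with h' the conjugate of h *)
  pose c : {poly k} := (2%:R : k)^-1%:P; pose h' := reflect_poly h.
  have rc p : reflect_poly (c * p) = c * reflect_poly p.
    by rewrite /reflect_poly comp_polyM comp_polyC.
  have rh' : reflect_poly h' = h := reflect_polyK h.
  have rD : reflect_poly (h + h') = h + h'.
    by rewrite -{2}rh' addrC /reflect_poly comp_polyD.
  have rB : reflect_poly (h - h') = - (h - h').
    by rewrite opprB -{2}rh' /reflect_poly comp_polyB.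
  exists (peval Z (c * (h + h'))), (peval Z (c * (h - h'))); split.
  - split; first by apply/FZ; eexists.
    by apply/adjP; rewrite -pD DQ rc rD.
  - split; first by apply/FZ; eexists.
    rewrite -block_mulrN; apply/adjP; rewrite -(rmorphN (peval Z)) -!pD DQ rc rB.
    by rewrite mulrN.
  rewrite defK -!pevalM -rmorphB /=; apply/eqP; rewrite -subr_eq0 -rmorphB Z0 /=.
  have -> : c * (h + h') * (c * (h + h')) - c * (h - h') * (c * (h - h')) =
      (c * 2%:R) ^+ 2 * (h * h').
    by ring.
  have -> : c * 2%:R = 1 by rewrite -polyC_natr -polyCM mulVf.
  by rewrite expr1n mul1r.
case=> X1 [Y1 [[/FZ[x defX] /adjP Xsa] [/FZ[y defY] Ysk] defK']].
have {}Ysk : (block_diag m'.+1 Y1)^T *m Q1 = Q1 *m block_diag m'.+1 (- Y1).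
  by apply/adjP; rewrite Ysk block_mulrN.
(* The adjoint of X + Y is X - Y, so H is an isometry from H1 K to H1. *)
pose H := block_diag m'.+1 (X1 + Y1).
have HQ : H^T *m Q1 = Q1 *m block_diag m'.+1 (X1 - Y1).
  by rewrite /H !linearD /= mulmxDl Xsa Ysk.
have HQH : H^T *m Q1 *m H = Q1 *m peval D r.
  rewrite HQ -mulmxA -block_diagM pD -defK defK'; congr (_ *m block_diag _ _).
  rewrite mulmxBl !mulmxDr defX defY (peval_comm _ y x) opprD addrA.
  by rewrite addrK.
have Du : peval D r \in unitmx.
  have [b rb] : exists b, peval Z r *m peval Z b = 1%:M.
    by apply: (peval_irred_unit q_irr qZ); rewrite -Z0 -defK.
  have : peval D r *m peval D b = 1%:M by rewrite !pD -block_diagM rb block_diag_scalar.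
  by case/mulmx1_unit.
have Hu : H \in unitmx.
  have : Q1 *m peval D r \in unitmx by rewrite unitmx_mul Q1u.
  by rewrite -HQH unitmx_mul => /andP[].
have HE : H *m E = E *m H.
  rewrite /H defX defY -rmorphD /= -pD; exact: peval_intertwine.
have [g gH] := lfun_mx_surj X_basis (invmx H).
have g_aut : sext_aut (sextuple_of eta) (diag3 g).
  by apply: (diag3_aut_of_mx X_basis); rewrite gH ?unitmx_inv // comm_invmx.
exists (diag3 g); split=> //; split; first by case: g_aut.
apply/isoP; rewrite gH -(mulmxA _ Q1) -HQH !mulmxA -trmx_mul mulmxV // trmx1 mul1mx.
by rewrite mulmxK.
Qed.
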